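(* Suppose that $f\in\mathcal{D}_2(\mathbf{L}_{q,\mathfrak{I}_N})$ is a solution of $\mathbf{L}_{q,\mathfrak{I}_N}f=0$ that does not vanish in the whole segment $[0,b]$. Then for every $\rho\in\mathbb{C}$ the functions $$u_0(\rho,x)=\sum_{k=0}^\infty\frac{(-1)^k\rho^{2k}\varphi_f^{(2k)}(x)}{(2k)!},\qquad u_1(\rho,x)=\sum_{k=0}^\infty\frac{(-1)^k\rho^{2k}\varphi_f^{(2k+1)}(x)}{(2k+1)!}$$ belong to $\mathcal{D}_2(\mathbf{L}_{q,\mathfrak{I}_N})$, and $\{u_0(\rho,x),u_1(\rho,x)\}$ is a fundamental set of solutions of $\mathbf{L}_{q,\mathfrak{I}_N}u=\rho^2u$ satisfying the initial conditions $$u_0(\rho,0)=f(0),\quad u_0'(\rho,0)=f'(0),\qquad u_1(\rho,0)=0,\quad u_1'(\rho,0)=\frac1{f(0)}.$$ Both series converge absolutely and uniformly on $x\in[0,b]$, the series of the derivatives converge in $L_2(0,b)$ and the series of the second derivatives converge in $L_2(x_j,x_{j+1})$, $j=0,\dots,N$. With respect to $\rho$ the series converge absolutely and uniformly on any compact subset of the complex $\rho$-plane.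
   Context: Let $b>0$, let $q\in L_2(0,b)$ be complex valued, $N\in\mathbb{N}$, $0<x_1<\dots<x_N<b$, $\alpha_1,\dots,\alpha_N\in\mathbb{C}\setminus\{0\}$, $x_0=0$, $x_{N+1}=b$, $\mathfrak{I}_N=\{(x_j,\alpha_j)\}_{j=1}^N$. $\mathcal{D}_2(\mathbf{L}_{q,\mathfrak{I}_N})$ is the set of $u\in AC[0,b]$ such that $u|_{(x_k,x_{k+1})}\in H^2(x_k,x_{k+1})$ for $k=0,\dots,N$ and $u'(x_k+)-u'(x_k-)=\alpha_ku(x_k)$ for $k=1,\dots,N$. A solution of $\mathbf{L}_{q,\mathfrak{I}_N}u=\lambda u$ (formally $-u''+(q+\sum_{k=1}^N\alpha_k\delta(x-x_k))u=\lambda u$) is a function $u\in\mathcal{D}_2(\mathbf{L}_{q,\mathfrak{I}_N})$ satisfying $-u''+qu=\lambda u$ a.e. on each $(x_k,x_{k+1})$. A fundamental set of solutions is a pair of linearly independent solutions spanning the (two-dimensional) solution space. Formal powers: put $\widetilde X^{(0)}\equiv X^{(0)}\equiv1$ and, for $k\in\mathbb{N}$, $$\widetilde X^{(k)}(x)=k\int_0^x\widetilde X^{(k-1)}(s)\left(f^2(s)\right)^{(-1)^{k-1}}ds,\qquad X^{(k)}(x)=k\int_0^xX^{(k-1)}(s)\left(f^2(s)\right)^{(-1)^k}ds.$$ Then $\varphi_f^{(k)}=f\widetilde X^{(k)}$ for $k$ even and $\varphi_f^{(k)}=fX^{(k)}$ for $k$ odd, $k\in\mathbb{N}_0$. *)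

(* Defs.v *)
From HB Require Import structures.
From mathcomp Require Import all_boot all_order all_algebra.
From mathcomp Require Import complex.
From mathcomp Require Import all_classical all_reals all_analysis.

Set Implicit Arguments.
Unset Strict Implicit.
Unset Printing Implicit Defensive.

Import Order.TTheory GRing.Theory Num.Theory.
Import numFieldNormedType.Exports.

Local Open Scope classical_set_scope.
Local Open Scope complex_scope.
Local Open Scope ring_scope.

Notation normc := ComplexField.Normc.normc.

(* Functions on the segment [0, b] are modelled by total functions R -> R[i];
   every notion below only depends on their values on the stated set.
   Limits, derivatives and integrals of complex-valued functions of a real
   variable are taken on the real and imaginary parts. *)

Definition ccvg (R : realType) (F : set_system R) (g : R -> R[i]) (l : R[i]) :=
  (complex.Re (g t) @[t --> F] --> complex.Re l) /\
  (complex.Im (g t) @[t --> F] --> complex.Im l).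

Definition clim (R : realType) (F : set_system R) (g : R -> R[i]) : R[i] :=
  lim (complex.Re (g t) @[t --> F]) +i* lim (complex.Im (g t) @[t --> F]).

Definition cderivable (R : realType) (u : R -> R[i]) (t : R) :=
  derivable (fun s => complex.Re (u s)) t 1 /\
  derivable (fun s => complex.Im (u s)) t 1.

Definition cderive (R : realType) (u : R -> R[i]) (t : R) : R[i] :=
  derive1 (fun s => complex.Re (u s)) t +i*
  derive1 (fun s => complex.Im (u s)) t.

Definition rquotient (R : realType) (u : R -> R[i]) (t h : R) : R[i] :=
  (h^-1)%:C * (u (t + h) - u t).

(* One-sided derivative, used at the left endpoint of [0, b]. *)
Definition rderive (R : realType) (u : R -> R[i]) (t : R) : R[i] :=
  clim 0^'+ (rquotient u t).

Definition is_rderive (R : realType) (u : R -> R[i]) (t : R) (d : R[i]) :=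
  ccvg 0^'+ (rquotient u t) d.

Definition cintegral (R : realType) (D : set R) (g : R -> R[i]) : R[i] :=
  (\int[lebesgue_measure]_(t in D) complex.Re (g t)) +i*
  (\int[lebesgue_measure]_(t in D) complex.Im (g t)).

Definition csum (R : realType) (t : nat -> R[i]) : R[i] :=
  limn (series (fun k => complex.Re (t k))) +i*
  limn (series (fun k => complex.Im (t k))).

Definition abs_cont (R : realType) (D : set R) (u : R -> R[i]) :=
  forall eps : R, 0 < eps -> exists2 delta : R, 0 < delta &
    forall (n : nat) (a b : 'I_n -> R),
      (forall i, a i <= b i /\ `[a i, b i] `<=` D) ->
      trivIset setT (fun i => `]a i, b i[%classic) ->
      \sum_(i < n) (b i - a i) < delta ->
      \sum_(i < n) normc (u (b i) - u (a i)) < eps.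

Definition L2norm (R : realType) (D : set R) (g : R -> R[i]) : \bar R :=
  ((\int[lebesgue_measure]_(t in D) (normc (g t) ^+ 2)%:E) `^ 2^-1)%E.

(* measurable_fun refers to the Borel sigma-algebra; passing to an a.e. equal
   function yields Lebesgue measurability. *)
Definition L2 (R : realType) (D : set R) (g : R -> R[i]) :=
  exists h : R -> R[i],
    [/\ {ae @lebesgue_measure R, forall t, D t -> g t = h t},
        measurable_fun D (fun t => complex.Re (h t)),
        measurable_fun D (fun t => complex.Im (h t)) &
        (L2norm D h < +oo)%E].

(* H^2(a, b) on a bounded interval, in its one-dimensional form: u is C^1, u' is
   absolutely continuous and u'' is in L_2.  Then u and u' are bounded, so they
   are in L_2(a, b) as well. *)
Definition H2 (R : realType) (a b : R) (u : R -> R[i]) :=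
  [/\ forall t, t \in `]a, b[ -> cderivable u t,
      abs_cont `]a, b[ (cderive u),
      {ae @lebesgue_measure R,
        forall t, t \in `]a, b[ -> cderivable (cderive u) t} &
      L2 `]a, b[ (cderive (cderive u))].

Definition jump (R : realType) (u : R -> R[i]) (t : R) (a : R[i]) :=
  exists dl dr : R[i],
    [/\ ccvg t^'- (cderive u) dl, ccvg t^'+ (cderive u) dr &
        dr - dl = a * u t].

(* The nodes are x 0 = 0, x 1, ..., x N, x N.+1 = b. *)
Definition D2 (R : realType) (b : R) (N : nat) (x : nat -> R)
    (alpha : nat -> R[i]) (u : R -> R[i]) :=
  [/\ abs_cont `[0, b] u,
      forall k, (k <= N)%N -> H2 (x k) (x k.+1) u &
      forall k, (1 <= k <= N)%N -> jump u (x k) (alpha k)].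

Definition is_solution (R : realType) (b : R) (q : R -> R[i]) (N : nat)
    (x : nat -> R) (alpha : nat -> R[i]) (lambda : R[i]) (u : R -> R[i]) :=
  D2 b N x alpha u /\
  forall k, (k <= N)%N ->
    {ae @lebesgue_measure R, forall t, t \in `]x k, x k.+1[ ->
      - cderive (cderive u) t + q t * u t = lambda * u t}.

Definition fundamental_set (R : realType) (b : R) (sol : (R -> R[i]) -> Prop)
    (u v : R -> R[i]) :=
  [/\ sol u, sol v,
      forall c d : R[i],
        (forall t, t \in `[0, b] -> c * u t + d * v t = 0) -> c = 0 /\ d = 0 &
      forall w, sol w -> exists c d : R[i],
        forall t, t \in `[0, b] -> w t = c * u t + d * v t].

(* Xtilde f k and Xpow f k are the formal powers \widetilde X^{(k)} and X^{(k)}. *)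
Fixpoint Xtilde (R : realType) (f : R -> R[i]) (k : nat) : R -> R[i] :=
  if k is k'.+1 then fun t => k%:R *
    cintegral `[0, t] (fun s => Xtilde f k' s * (f s ^+ 2) ^ ((-1 : int) ^+ k'))
  else fun=> 1.

Fixpoint Xpow (R : realType) (f : R -> R[i]) (k : nat) : R -> R[i] :=
  if k is k'.+1 then fun t => k%:R *
    cintegral `[0, t] (fun s => Xpow f k' s * (f s ^+ 2) ^ ((-1 : int) ^+ k))
  else fun=> 1.

Definition phi (R : realType) (f : R -> R[i]) (k : nat) (t : R) : R[i] :=
  f t * (if odd k then Xpow f k t else Xtilde f k t).

(* i = 0 and i = 1 give the terms of the series of u_0 and u_1 *)
Definition spps_term (R : realType) (f : R -> R[i]) (i : nat) (rho : R[i])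
    (k : nat) (t : R) : R[i] :=
  (-1) ^+ k * rho ^+ (2 * k) * phi f (2 * k + i) t / ((2 * k + i)`!)%:R.

Definition spps (R : realType) (f : R -> R[i]) (i : nat) (rho : R[i]) (t : R) :=
  csum (fun k => spps_term f i rho k t).

Definition abs_unif_cvg (R : realType) (T : Type) (A : set T)
    (t : nat -> T -> R[i]) (s : T -> R[i]) :=
  (forall y, A y -> cvgn (series (fun k => normc (t k y)))) /\
  (forall eps : R, 0 < eps -> \forall n \near \oo,
     forall y, A y -> normc (\sum_(0 <= k < n) t k y - s y) < eps).

Definition L2_cvg (R : realType) (D : set R) (t : nat -> R -> R[i])
    (s : R -> R[i]) :=
  [/\ forall k, L2 D (t k), L2 D s &
      L2norm D (fun y => \sum_(0 <= k < n) t k y - s y) @[n --> \oo] --> 0%E].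

(* Series of L_2(D)-valued functions of a complex parameter ranging over K. *)
Definition L2_abs_unif_cvg (R : realType) (K : set R[i]) (D : set R)
    (t : R[i] -> nat -> R -> R[i]) (s : R[i] -> R -> R[i]) :=
  (forall rho, K rho ->
     (\sum_(0 <= k <oo) L2norm D (t rho k) < +oo)%E) /\
  (forall eps : R, 0 < eps -> \forall n \near \oo, forall rho, K rho ->
     (L2norm D (fun y => \sum_(0 <= k < n) t rho k y - s rho y)%R < eps%:E)%E).

(* Main.v *)
Require Import Defs.
From HB Require Import structures.
From mathcomp Require Import all_boot all_order all_algebra.
From mathcomp Require Import complex.
From mathcomp Require Import all_classical all_reals all_analysis.
From mathcomp Require Import measurable_realfun ring lra zify.

(** Why the theorem holds.

    Write F for f, continued by constants outside [0, b].  Each term of the two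
    series is F y_k, where y_k is a multiple of an iterated integral of F^2 and
    F^-2 taken in alternation; with z_k the same multiple of the iterated integral
    of one order less, the parity of the indices gives

      y_k' = F^-2 z_k,        z_k' = - rho^2 F^2 y_(k-1).

    F^2 and F^-2 are bounded on [0, b], so an iterated integral of order m is at
    most A^m / m! (iterint_le), and y_k, z_k are dominated, uniformly for
    bounded rho, by the terms of an exponential series (iter_bound).  Hence the
    sums y and z exist and may be differentiated termwise (is_cderive_csum):
    y' = F^-2 z and z' = - rho^2 F^2 y.

    For any u = F y with y' = F^-2 z one has u' = f' y + F^-1 z, and in u'' the
    two terms containing f' z cancel: u'' = f'' y + F^-1 z' = q u + F^-1 z' almost
    everywhere.  Since y and z are continuous, all the roughness of u' comes from
    f' y: its regularity and its jumps at the nodes are those of f' multiplied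
    by y.  This is the content of the factor_ lemmas.  They apply to
    the sums, which are therefore solutions (spps_solution); to each single
    term, whose derivatives are therefore explicit and bounded by a summable
    constant times a fixed square-integrable function, 1 or 1 + |q|, which gives
    the convergence in L_2 uniformly in rho (L2_normal_series); and to f itself,
    with y = 1 and z = 0.

    It remains to see that u_0 and u_1 span the solutions.  The Wronskian of two
    solutions is absolutely continuous on each open piece with derivative zero
    almost everywhere, hence constant there.  This classical fact is proved by
    Cousin's covering argument (abs_cont_derive0).  The jumps of the
    derivatives at a node cancel in the Wronskian, so it is one constant on all
    the pieces (wronskian_const).  For u_0 and u_1 that constant is
    y_0 z_1 - z_0 y_1 at 0, which is 1, and then any solution w is recovered from
    its Wronskians with u_0 and u_1 (wronskian_fundamental). *)

Set Implicit Arguments.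
Unset Strict Implicit.
Unset Printing Implicit Defensive.

Import Order.TTheory GRing.Theory Num.Theory.
Import numFieldNormedType.Exports.

Local Open Scope classical_set_scope.
Local Open Scope complex_scope.
Local Open Scope ring_scope.

(** * The modulus of complex numbers *)

Section modulus.
Context {R : realType}.
Implicit Types z w : R[i].

Lemma cRe_add z w : complex.Re (z + w) = complex.Re z + complex.Re w.
Proof. by case: z; case: w. Qed.

Lemma cIm_add z w : complex.Im (z + w) = complex.Im z + complex.Im w.
Proof. by case: z; case: w. Qed.

Lemma cRe_opp z : complex.Re (- z) = - complex.Re z.
Proof. by case: z. Qed.

Lemma cIm_opp z : complex.Im (- z) = - complex.Im z.
Proof. by case: z. Qed.

Lemma cRe_mul z w :
  complex.Re (z * w) = complex.Re z * complex.Re w - complex.Im z * complex.Im w.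
Proof. by case: z; case: w. Qed.

Lemma cIm_mul z w :
  complex.Im (z * w) = complex.Re z * complex.Im w + complex.Im z * complex.Re w.
Proof. by case: z; case: w. Qed.

Lemma cRe_inv z :
  complex.Re z^-1 = complex.Re z * (complex.Re z ^+ 2 + complex.Im z ^+ 2)^-1.
Proof. by case: z. Qed.

Lemma cIm_inv z :
  complex.Im z^-1 = - complex.Im z * (complex.Re z ^+ 2 + complex.Im z ^+ 2)^-1.
Proof. by case: z => a b; rewrite /= mulNr. Qed.

Lemma complex_eq z w :
  complex.Re z = complex.Re w -> complex.Im z = complex.Im w -> z = w.
Proof. by case: z w => [a b] [c d] /= -> ->. Qed.

Lemma normc_sqrt z :
  normc z = Num.sqrt (complex.Re z ^+ 2 + complex.Im z ^+ 2).
Proof. by case: z. Qed.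

Lemma normc_ge0 z : 0 <= normc z.
Proof. by rewrite normc_sqrt sqrtr_ge0. Qed.

Lemma normc_eq0 z : (normc z == 0) = (z == 0).
Proof.
apply/eqP/eqP => [/ComplexField.Normc.eq0_normc//|->].
exact: ComplexField.Normc.normc0.
Qed.

Lemma normc_gt0 z : z != 0 -> 0 < normc z.
Proof. by move=> z0; rewrite lt_neqAle normc_ge0 eq_sym normc_eq0 z0. Qed.

Lemma normcX z n : normc (z ^+ n) = normc z ^+ n.
Proof.
elim: n => [|n IH]; first by rewrite !expr0 ComplexField.Normc.normc1.
by rewrite !exprS ComplexField.Normc.normcM IH.
Qed.

Lemma Re2_Im2_gt0 z : z != 0 -> 0 < complex.Re z ^+ 2 + complex.Im z ^+ 2.
Proof. by move=> /normc_gt0; rewrite normc_sqrt sqrtr_gt0. Qed.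

Lemma normcB z w : normc (z - w) = normc (w - z).
Proof. by rewrite -normcN opprB. Qed.

Lemma abs_Re_normc z : `|complex.Re z| <= normc z.
Proof. by rewrite normc_sqrt -sqrtr_sqr ler_wsqrtr// lerDl sqr_ge0. Qed.

Lemma abs_Im_normc z : `|complex.Im z| <= normc z.
Proof. by rewrite normc_sqrt -sqrtr_sqr ler_wsqrtr// lerDr sqr_ge0. Qed.

Lemma normc_le_abs z : normc z <= `|complex.Re z| + `|complex.Im z|.
Proof.
rewrite normc_sqrt -(ler_pXn2r (ltn0Sn 1)) ?nnegrE ?sqrtr_ge0 ?addr_ge0//.
rewrite sqr_sqrtr ?addr_ge0 ?sqr_ge0// sqrrD !real_normK ?num_real//.
by rewrite -addrA lerD2l lerDr mulrn_wge0// mulr_ge0.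
Qed.

End modulus.

Definition cReE {R : realType} := (@cRe_add R, @cRe_opp R, @cRe_mul R).
Definition cImE {R : realType} := (@cIm_add R, @cIm_opp R, @cIm_mul R).
Notation normcM := ComplexField.Normc.normcM.
Notation normcV := ComplexField.Normc.normcV.

(** * Limits and continuity of complex-valued functions *)

Section limits.
Context {R : realType}.
Implicit Types (F : set_system R) (u v : R -> R[i]) (l m : R[i]).

(** Passes from limits in each component to estimates of the modulus. *)
Lemma ccvgP F {FF : ProperFilter F} u l :
  ccvg F u l <-> forall e : R, 0 < e -> \forall t \near F, normc (u t - l) < e.
Proof.
split=> [[/cvgrPdist_lt Rel /cvgrPdist_lt Iml] e e0|H].
  have e2 : 0 < e / 2 by rewrite divr_gt0.
  near=> t.
  apply: le_lt_trans (normc_le_abs _) _.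
  rewrite !cReE !cImE (splitr e) ltrD// distrC.
    by near: t; exact: Rel.
  by near: t; exact: Iml.
split; apply/cvgrPdist_lt => e e0; near=> t; rewrite distrC.
  apply: le_lt_trans (_ : normc (u t - l) < e).
    by apply: le_trans (abs_Re_normc _); rewrite !cReE.
  by near: t; exact: H.
apply: le_lt_trans (_ : normc (u t - l) < e).
  by apply: le_trans (abs_Im_normc _); rewrite !cImE.
by near: t; exact: H.
Unshelve. all: by end_near. Qed.

Lemma ccvg_cst F {FF : Filter F} l : ccvg F (fun=> l) l.
Proof. by split; exact: cvg_cst. Qed.

Lemma ccvgD F {FF : Filter F} u v l m :
  ccvg F u l -> ccvg F v m -> ccvg F (fun t => u t + v t) (l + m).
Proof.
move=> [ul1 ul2] [vm1 vm2]; split; rewrite (cReE, cImE).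
  by under eq_fun do rewrite cReE; exact: cvgD.
by under eq_fun do rewrite cImE; exact: cvgD.
Qed.

Lemma ccvgN F {FF : Filter F} u l : ccvg F u l -> ccvg F (fun t => - u t) (- l).
Proof.
move=> [ul1 ul2]; split; rewrite (cReE, cImE).
  by under eq_fun do rewrite cReE; exact: cvgN.
by under eq_fun do rewrite cImE; exact: cvgN.
Qed.

Lemma ccvgB F {FF : Filter F} u v l m :
  ccvg F u l -> ccvg F v m -> ccvg F (fun t => u t - v t) (l - m).
Proof. by move=> ul vm; apply: ccvgD => //; exact: ccvgN. Qed.

Lemma ccvgM F {FF : Filter F} u v l m :
  ccvg F u l -> ccvg F v m -> ccvg F (fun t => u t * v t) (l * m).
Proof.
move=> [ul1 ul2] [vm1 vm2]; split; rewrite (cReE, cImE).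
  by under eq_fun do rewrite cReE; apply: cvgB; exact: cvgM.
by under eq_fun do rewrite cImE; apply: cvgD; exact: cvgM.
Qed.

Lemma ccvgV F {FF : Filter F} u l :
  l != 0 -> ccvg F u l -> ccvg F (fun t => (u t)^-1) l^-1.
Proof.
move=> l0 [ul1 ul2].
have D : (complex.Re (u t) ^+ 2 + complex.Im (u t) ^+ 2)^-1 @[t --> F] -->
    (complex.Re l ^+ 2 + complex.Im l ^+ 2)^-1.
  apply: cvgV; first by rewrite gt_eqF// Re2_Im2_gt0.
  by apply: cvgD; rewrite expr2; under eq_fun do rewrite expr2; exact: cvgM.
split; rewrite (cRe_inv, cIm_inv).
  by under eq_fun do rewrite cRe_inv; exact: cvgM.
by under eq_fun do rewrite cIm_inv; apply: cvgM => //; exact: cvgN.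
Qed.

Lemma ccvg_unique F {FF : ProperFilter F} u l m :
  ccvg F u l -> ccvg F u m -> l = m.
Proof.
move=> [ul1 ul2] [um1 um2]; apply: complex_eq.
  exact: (cvg_unique _ ul1 um1).
exact: (cvg_unique _ ul2 um2).
Qed.

Lemma ccvg_near F {FF : Filter F} u v l :
  (\forall t \near F, u t = v t) -> ccvg F u l -> ccvg F v l.
Proof.
move=> uv [ul1 ul2]; split; (apply: cvg_trans; last eassumption);
  by apply: near_eq_cvg; apply: filterS uv => t ->.
Qed.

Definition ccontinuous u := forall t, ccvg (nbhs t) u (u t).

Lemma ccontinuous_Re u : ccontinuous u -> continuous (fun t => complex.Re (u t)).
Proof. by move=> cu t; case: (cu t). Qed.

Lemma ccontinuous_Im u : ccontinuous u -> continuous (fun t => complex.Im (u t)).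
Proof. by move=> cu t; case: (cu t). Qed.

Lemma ccontinuous_normc u : ccontinuous u -> continuous (fun t => normc (u t)).
Proof.
move=> cu t.
rewrite (_ : (fun t => _) = Num.sqrt \o
  (fun t => complex.Re (u t) ^+ 2 + complex.Im (u t) ^+ 2)); last first.
  by apply/funext => s; rewrite /= normc_sqrt.
apply: (@continuous_cvg _ _ _ _ _ _ Num.sqrt); first exact: sqrt_continuous.
have [cr ci] := cu t.
by apply: cvgD; rewrite expr2; under eq_fun do rewrite expr2; exact: cvgM.
Qed.

Lemma ccontinuous_cst l : ccontinuous (fun=> l).
Proof. by move=> t; exact: ccvg_cst. Qed.

Lemma ccontinuousM u v :
  ccontinuous u -> ccontinuous v -> ccontinuous (fun t => u t * v t).
Proof. by move=> cu cv t; exact: ccvgM. Qed.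

Lemma ccontinuousD u v :
  ccontinuous u -> ccontinuous v -> ccontinuous (fun t => u t + v t).
Proof. by move=> cu cv t; exact: ccvgD. Qed.

Lemma ccontinuousV u : (forall t, u t != 0) ->
  ccontinuous u -> ccontinuous (fun t => (u t)^-1).
Proof. by move=> u0 cu t; exact: ccvgV. Qed.

Lemma ccvg_at_right u t : ccontinuous u -> ccvg t^'+ u (u t).
Proof. by move=> cu; have [? ?] := cu t; split; exact: cvg_at_right_filter. Qed.

Lemma ccvg_at_left u t : ccontinuous u -> ccvg t^'- u (u t).
Proof. by move=> cu; have [? ?] := cu t; split; exact: cvg_at_left_filter. Qed.

(** The modulus is continuous, so the image of a compact set is compact in R. *)
Lemma compact_normc_bounded (K : set R[i]) : compact (K : set R[i]^o) ->
  exists P : R, forall rho, K rho -> normc rho <= P.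
Proof.
move=> cK.
have cn : continuous (fun z : R[i]^o => normc (z : R[i])).
  move=> z A /nbhs_ballP[e /= e0 eA].
  have ec : 0 < e%:C by rewrite ltcR.
  have sub : ball (z : R[i]^o) e%:C `<=` [set w | A (normc w)]; last first.
    by apply/(@nbhs_ballP R[i] R[i]^o); exists (e%:C).
  move=> w; rewrite -ball_normE /= => zw; apply: eA; rewrite /ball/=.
  have {}zw : normc (z - w) < e by rewrite -ltcR.
  have := le_normcD (z - w) w; have := le_normcD (w - z) z.
  rewrite !subrK (normcB w) => h1 h2; rewrite ltr_norml.
  by apply/andP; split; lra.
have cnK : compact ((fun z : R[i]^o => normc (z : R[i])) @` K).
  exact: (continuous_compact (continuous_subspaceT cn) cK).
have [P [_ HP]] := compact_bounded cnK.
exists (`|P| + 1) => rho Krho; apply: le_trans (ler_norm _) (HP _ _ _ _) => //.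
  by rewrite ltr_pwDr// ler_norm.
by exists rho.
Qed.

End limits.

(** * Derivatives of complex-valued functions *)

(** Locked, since automation would otherwise unfold it down to limits. *)
HB.lock Definition is_cderive {R : realType} (u : R -> R[i]) (t : R) (d : R[i]) :=
  is_derive t 1 (fun s => complex.Re (u s)) (complex.Re d) /\
  is_derive t 1 (fun s => complex.Im (u s)) (complex.Im d).

Section derivatives.
Context {R : realType}.
Implicit Types (u v : R -> R[i]) (d e : R[i]).

Lemma is_cderive_parts u t d : is_cderive u t d <->
  is_derive t 1 (fun s => complex.Re (u s)) (complex.Re d) /\
  is_derive t 1 (fun s => complex.Im (u s)) (complex.Im d).
Proof. rewrite is_cderive.unlock; exact: iff_refl. Qed.

Lemma is_cderiveP u t : cderivable u t -> is_cderive u t (cderive u t).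
Proof.
case=> dr di; apply/is_cderive_parts; rewrite /cderive !derive1E.
by split; [exact: (derivableP dr)|exact: (derivableP di)].
Qed.

Lemma is_cderive_derivable u t d : is_cderive u t d -> cderivable u t.
Proof. by case/is_cderive_parts => dr di; split; exact: ex_derive. Qed.

Lemma is_cderiveE u t d : is_cderive u t d -> cderive u t = d.
Proof.
case/is_cderive_parts => dr di.
by apply: complex_eq; rewrite /= derive1E; exact: derive_val.
Qed.

Lemma is_cderive_cst d t : is_cderive (fun=> d) t 0.
Proof. by apply/is_cderive_parts; split; exact: is_derive_cst. Qed.

Lemma is_cderiveD u v t d e : is_cderive u t d -> is_cderive v t e ->
  is_cderive (fun s => u s + v s) t (d + e).
Proof.
move=> /is_cderive_parts[dr di] /is_cderive_parts[er ei].
apply/is_cderive_parts; split; rewrite (cReE, cImE).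
  by under eq_fun do rewrite cReE; exact: is_deriveD.
by under eq_fun do rewrite cImE; exact: is_deriveD.
Qed.

Lemma is_cderiveN u t d : is_cderive u t d ->
  is_cderive (fun s => - u s) t (- d).
Proof.
move=> /is_cderive_parts[dr di]; apply/is_cderive_parts; split; rewrite (cReE, cImE).
  by under eq_fun do rewrite cReE; exact: is_deriveN.
by under eq_fun do rewrite cImE; exact: is_deriveN.
Qed.

Lemma is_cderiveB u v t d e : is_cderive u t d -> is_cderive v t e ->
  is_cderive (fun s => u s - v s) t (d - e).
Proof. by move=> du dv; apply: is_cderiveD => //; exact: is_cderiveN. Qed.

Lemma is_cderiveM u v t d e : is_cderive u t d -> is_cderive v t e ->
  is_cderive (fun s => u s * v s) t (d * v t + u t * e).
Proof.
move=> /is_cderive_parts[dr di] /is_cderive_parts[er ei].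
apply/is_cderive_parts; split; rewrite !(cReE, cImE).
  under eq_fun do rewrite cReE.
  have D := is_deriveB (is_deriveM dr er) (is_deriveM di ei).
  apply: (is_derive_eq D).
  by rewrite /GRing.scale /=; ring.
under eq_fun do rewrite cImE.
have D := is_deriveD (is_deriveM dr ei) (is_deriveM di er).
apply: (is_derive_eq D).
by rewrite /GRing.scale /=; ring.
Qed.

Lemma is_cderiveZ (c : R[i]) u t d : is_cderive u t d ->
  is_cderive (fun s => c * u s) t (c * d).
Proof.
move=> du; have := is_cderiveM (is_cderive_cst c t) du.
by rewrite mul0r add0r.
Qed.

Lemma is_cderive_near u v t d : (\forall s \near t, u s = v s) ->
  is_cderive u t d -> is_cderive v t d.
Proof.
move=> uv /is_cderive_parts[dr di]; apply/is_cderive_parts; split.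
  by apply: near_eq_is_derive dr; apply: filterS uv => s ->.
by apply: near_eq_is_derive di; apply: filterS uv => s ->.
Qed.

Lemma is_cderive_ext u v t d : u =1 v -> is_cderive u t d -> is_cderive v t d.
Proof. by move=> /funext ->. Qed.

Lemma is_cderiveV u t d : u t != 0 -> is_cderive u t d ->
  is_cderive (fun s => (u s)^-1) t (- d / u t ^+ 2).
Proof.
move=> u0 /is_cderive_parts[dr di].
pose D s : R := complex.Re (u s) ^+ 2 + complex.Im (u s) ^+ 2.
have D0 : D t != 0 by rewrite gt_eqF// Re2_Im2_gt0.
have dD : is_derive t 1 D (2 * complex.Re (u t) * complex.Re d +
                           2 * complex.Im (u t) * complex.Im d).
  rewrite (_ : D = (fun s => complex.Re (u s)) ^+ 2 +
                   (fun s => complex.Im (u s)) ^+ 2); last first.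
    by apply/funext => s; rewrite /D !fctE.
  have E := is_deriveD (is_deriveX 2 dr) (is_deriveX 2 di).
  apply: (is_derive_eq E).
  by rewrite /GRing.scale /= !expr1; ring.
have dV : is_derive t 1 (fun s => (D s)^-1)
    (- (D t) ^- 2 * (2 * complex.Re (u t) * complex.Re d +
                     2 * complex.Im (u t) * complex.Im d)).
  split; first by apply: derivableV => //; exact: ex_derive.
  by rewrite deriveV// ?derive_val//; exact: ex_derive.
have E2 : u t ^+ 2 = (complex.Re (u t) ^+ 2 - complex.Im (u t) ^+ 2) +i*
          (2 * complex.Re (u t) * complex.Im (u t)).
  by case: (u t) => a c; rewrite expr2; apply: complex_eq; rewrite /=; ring.
have E4 : (complex.Re (u t) ^+ 2 - complex.Im (u t) ^+ 2) ^+ 2 +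
    (2 * complex.Re (u t) * complex.Im (u t)) ^+ 2 = D t ^+ 2.
  by rewrite /D; ring.
apply/is_cderive_parts; split; rewrite E2 !(cReE, cImE, cRe_inv, cIm_inv) /= E4.
  under eq_fun do rewrite cRe_inv.
  have E := is_deriveM dr dV.
  apply: (is_derive_eq E).
  rewrite /GRing.scale /= -/(D t); move: D0; rewrite /D => D0.
  by field.
under eq_fun do rewrite cIm_inv.
have E := is_deriveM (is_deriveN di) dV.
apply: (is_derive_eq E).
rewrite /GRing.scale /= -/(D t); move: D0; rewrite /D => D0.
by rewrite !fctE; field.
Qed.

End derivatives.

(** * Absolute continuity *)

Section abs_cont.
Context {R : realType}.
Implicit Types (D : set R) (u v w : R -> R[i]).

Lemma abs_contS D D' u : D' `<=` D -> abs_cont D u -> abs_cont D' u.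
Proof.
move=> DD uD e e0; have [d d0 H] := uD e e0; exists d => // n a b ab.
by apply: H => i; have [? ?] := ab i; split=> //; exact: subset_trans DD.
Qed.

(** The estimate behind the stability of absolute continuity under sums,
    products and inverses. *)
Lemma abs_cont_dom D (C : R) u v w : 0 <= C ->
  (forall s t, D s -> D t ->
    normc (w t - w s) <= C * (normc (u t - u s) + normc (v t - v s))) ->
  abs_cont D u -> abs_cont D v -> abs_cont D w.
Proof.
move=> C0 wuv uD vD e e0.
(* C + 1 rather than C keeps the denominator positive when C = 0. *)
have e1 : 0 < e / (C + 1) / 2 by rewrite !divr_gt0// ltr_wpDl.
have [d d0 Hd] := uD _ e1; have [d' d'0 Hd'] := vD _ e1.
exists (Num.min d d'); first by rewrite lt_min d0.
move=> n a b ab T; rewrite lt_min => /andP[L L'].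
have abD i : D (a i) /\ D (b i).
  by have [h1 h2] := ab i; split; apply: h2; rewrite /= in_itv/= h1 lexx.
apply: (@le_lt_trans _ _ (C * (\sum_(i < n) normc (u (b i) - u (a i)) +
                         \sum_(i < n) normc (v (b i) - v (a i))))).
  by rewrite -big_split/= mulr_sumr; apply: ler_sum => i _; apply: wuv; apply abD.
have : \sum_(i < n) normc (u (b i) - u (a i)) +
       \sum_(i < n) normc (v (b i) - v (a i)) < e / (C + 1).
  by rewrite [ltRHS]splitr ltrD// ?Hd// Hd'.
have S0 : 0 <= \sum_(i < n) normc (u (b i) - u (a i)) +
       \sum_(i < n) normc (v (b i) - v (a i)).
  by rewrite addr_ge0// sumr_ge0// => i _; exact: normc_ge0.
rewrite ltr_pdivlMr ?ltr_wpDl// => H; apply: le_lt_trans H.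
by rewrite [leRHS]mulrDr mulr1 mulrC lerDl.
Qed.

Lemma abs_cont_eq D u v : (forall t, D t -> u t = v t) ->
  abs_cont D u -> abs_cont D v.
Proof.
move=> uv uD; apply: (@abs_cont_dom D 1 u u v) => // s t Ds Dt.
by rewrite mul1r -!uv// lerDl normc_ge0.
Qed.

Lemma abs_contD D u v : abs_cont D u -> abs_cont D v ->
  abs_cont D (fun t => u t + v t).
Proof.
apply: (@abs_cont_dom D 1) => // s t _ _; rewrite mul1r opprD addrACA.
exact: le_normcD.
Qed.

Lemma abs_contM D (C : R) u v : 0 <= C ->
  (forall t, D t -> normc (u t) <= C) -> (forall t, D t -> normc (v t) <= C) ->
  abs_cont D u -> abs_cont D v -> abs_cont D (fun t => u t * v t).
Proof.
move=> C0 uC vC; apply: (@abs_cont_dom D C) => // s t Ds Dt.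
rewrite (_ : _ - _ = (u t - u s) * v t + u s * (v t - v s)); last by ring.
apply: le_trans (le_normcD _ _) _; rewrite [leRHS]mulrDr !normcM.
by rewrite lerD// ?ler_wpM2r ?normc_ge0 ?uC// mulrC ler_wpM2r ?normc_ge0 ?vC.
Qed.

Lemma abs_contV D (C : R) u : 0 <= C ->
  (forall t, D t -> u t != 0) -> (forall t, D t -> normc (u t)^-1 <= C) ->
  abs_cont D u -> abs_cont D (fun t => (u t)^-1).
Proof.
move=> C0 u0 uC uD.
apply: (@abs_cont_dom D (C * C) u u) => //; first by rewrite mulr_ge0.
move=> s t Ds Dt.
rewrite (_ : _ - _ = (u s)^-1 * (u t)^-1 * (u s - u t)); last first.
  by field; rewrite !u0.
rewrite normcM normcM (normcB (u s)); apply: ler_pM; rewrite ?mulr_ge0 ?normc_ge0//.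
  by apply: ler_pM; rewrite ?normc_ge0 ?uC.
by rewrite lerDl normc_ge0.
Qed.

Lemma lipschitz_abs_cont D (C : R) u : 0 <= C ->
  (forall s t, s <= t -> D s -> D t -> normc (u t - u s) <= C * (t - s)) ->
  abs_cont D u.
Proof.
move=> C0 uL e e0; exists (e / (C + 1)); first by rewrite divr_gt0// ltr_wpDl.
move=> n a b ab _ L.
apply: (@le_lt_trans _ _ (C * \sum_(i < n) (b i - a i))).
  rewrite mulr_sumr; apply: ler_sum => i _; have [h1 h2] := ab i.
  by apply: uL => //; apply: h2; rewrite /= in_itv/= h1 lexx.
move: L; rewrite ltr_pdivlMr ?ltr_wpDl//; apply: le_lt_trans.
rewrite mulrDr mulr1 mulrC lerDl sumr_ge0// => i _; rewrite subr_ge0.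
by have [] := ab i.
Qed.

Lemma abs_cont_unif D u (e : R) : 0 < e -> abs_cont D u ->
  exists2 d : R, 0 < d & forall s t, s <= t -> `[s, t] `<=` D -> t - s < d ->
    normc (u t - u s) < e.
Proof.
move=> e0 uD; have [d d0 H] := uD e e0; exists d => // s t st stD tsd.
have := H 1 (fun=> s) (fun=> t); rewrite !big_ord1; apply=> //.
by move=> i j _ _ _; rewrite (ord1 i) (ord1 j).
Qed.

Let subset_itv_cc (a b s t : R) :
  s \in `]a, b[ -> t \in `]a, b[ -> `[s, t] `<=` `]a, b[.
Proof.
move=> sab tab r /=; rewrite !in_itv/= => /andP[sr rt].
by rewrite (lt_le_trans _ sr) ?(itvP sab)// (le_lt_trans rt) ?(itvP tab).
Qed.

(** Every point is reached from the midpoint by finitely many steps of the length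
    that uniform continuity gives for e = 1, so |u| grows by at most the number
    of steps. *)
Lemma abs_cont_bounded (a b : R) u : abs_cont `]a, b[ u ->
  exists2 C : R, 0 <= C & forall t, t \in `]a, b[ -> normc (u t) <= C.
Proof.
move=> uD; have [d d0 H] := abs_cont_unif ltr01 uD.
have [ab|ba] := ltP a b; last first.
  exists 0 => // t; rewrite in_itv/= => /andP[/lt_trans h/h].
  by move=> /lt_le_trans/(_ ba); rewrite ltxx.
pose c := (a + b) / 2.
have cab : c \in `]a, b[ by rewrite in_itv/= /c; apply/andP; split; lra.
have step k t : t \in `]a, b[ -> `|t - c| < d * k%:R -> normc (u t - u c) <= k%:R.
  elim: k t => [|k IH] t tab; first by rewrite mulr0 normr_lt0.
  (* s is the point of [c, t] reached after k of the k + 1 equal steps. *)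
  move=> tc; pose s := c + (t - c) * (k%:R / k.+1%:R).
  have k1 : 0 < k.+1%:R :> R by rewrite ltr0n.
  have ts : t - s = (t - c) / k.+1%:R.
    by rewrite /s -natr1; field; rewrite natr1 gt_eqF.
  have q01 : 0 <= (k%:R / k.+1%:R : R) < 1.
    by rewrite divr_ge0 ?ler0n//= ltr_pdivrMr// mul1r ltr_nat.
  have sab : s \in `]a, b[.
    case/andP: q01 => q0 q1; rewrite in_itv/= /s.
    rewrite (_ : c + _ = t * (k%:R / k.+1%:R) + c * (1 - k%:R / k.+1%:R)); last by ring.
    set q := k%:R / _ in q0 q1 *.
    have [at_ tb] : a < t /\ t < b by rewrite !(itvP tab).
    have [ac cb] : a < c /\ c < b by rewrite !(itvP cab).
    by apply/andP; split; nra.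
  have sc : `|s - c| < d * k%:R \/ s = c.
    case: k @s k1 ts q01 sab tc {IH} => [|k] s k1 ts q01 sab tc.
      by right; rewrite /s mul0r mulr0 addr0.
    left; rewrite /s addrC addKr normrM.
    rewrite (_ : d * k.+1%:R = d * k.+2%:R * (k.+1%:R / k.+2%:R)); last first.
      by field; rewrite gt_eqF.
    by rewrite [X in _ * X < _]ger0_norm ?divr_ge0// ltr_pM2r// divr_gt0.
  rewrite (_ : u t - u c = (u t - u s) + (u s - u c)); last by ring.
  apply: le_trans (le_normcD _ _) _; rewrite -natr1 addrC; apply: lerD.
    case: sc => [/IH -> //|->].
    by rewrite subrr ComplexField.Normc.normc0 ler0n.
  have tsd : `|t - s| < d.
    by rewrite ts normrM [X in _ * X]gtr0_norm ?invr_gt0// ltr_pdivrMr.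
  have [st|/ltW ts'] := leP s t.
    by rewrite ltW// H//; [exact: subset_itv_cc|rewrite (le_lt_trans (ler_norm _))].
  rewrite ltW// normcB H//; [exact: subset_itv_cc|].
  by rewrite (le_lt_trans (ler_norm _))// distrC.
exists ((Num.truncn ((b - a) / d)).+1%:R + normc (u c)).
  by rewrite addr_ge0 ?ler0n// normc_ge0.
move=> t tab; rewrite -[u t](subrK (u c)); apply: le_trans (le_normcD _ _) _.
rewrite lerD2r; apply: step => //.
apply: (@lt_trans _ _ (b - a)).
  have [at_ tb] : a < t /\ t < b by rewrite !(itvP tab).
  have [ac cb] : a < c /\ c < b by rewrite !(itvP cab).
  by rewrite ltr_norml; apply/andP; split; lra.
by rewrite mulrC -ltr_pdivrMr// truncnS_gt// divr_ge0 ?subr_ge0 ?ltW.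
Qed.

(** Absolute continuity makes the values near the endpoint a Cauchy filter. *)
Lemma abs_cont_cvg_right (a b : R) u : a < b -> abs_cont `]a, b[ u ->
  exists l, ccvg a^'+ u l.
Proof.
move=> ab uD.
have key e : 0 < e -> exists s, \forall t \near a^'+, normc (u s - u t) < e.
  move=> e0; have [d d0 H] := abs_cont_unif e0 uD.
  pose s := a + Num.min d (b - a) / 2.
  have m0 : 0 < Num.min d (b - a) by rewrite lt_min d0 subr_gt0.
  have [md mb] : Num.min d (b - a) <= d /\ Num.min d (b - a) <= b - a.
    by rewrite !ge_min !lexx orbT.
  have sab : s \in `]a, b[ by rewrite in_itv/= /s; apply/andP; split; lra.
  exists s; near=> t.
  have at_ : a < t by near: t; exact: nbhs_right_gt.
  have ts : t < s.
    by near: t; apply: nbhs_right_lt; rewrite /s; lra.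
  rewrite H ?ltW//; last by rewrite /s in ts *; lra.
  apply: subset_itv_cc => //; rewrite in_itv/= at_/=; apply: lt_trans ts _.
  by rewrite (itvP sab).
have cR : cvg (complex.Re (u t) @[t --> a^'+]).
  apply/cauchy_cvgP/cauchy_exP => e e0; have [s Hs] := key e e0.
  exists (complex.Re (u s)).
  suff : \forall t \near a^'+, `|complex.Re (u s) - complex.Re (u t)| < e by [].
  apply: filterS Hs => t; apply: le_lt_trans.
  by apply: le_trans (abs_Re_normc _); rewrite !cReE.
have cI : cvg (complex.Im (u t) @[t --> a^'+]).
  apply/cauchy_cvgP/cauchy_exP => e e0; have [s Hs] := key e e0.
  exists (complex.Im (u s)).
  suff : \forall t \near a^'+, `|complex.Im (u s) - complex.Im (u t)| < e by [].
  apply: filterS Hs => t; apply: le_lt_trans.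
  by apply: le_trans (abs_Im_normc _); rewrite !cImE.
by exists (lim (complex.Re (u t) @[t --> a^'+]) +i*
           lim (complex.Im (u t) @[t --> a^'+])); split.
Unshelve. all: by end_near. Qed.

Lemma abs_cont_continuous_oo (a c t : R) (u : R -> R[i]) :
  abs_cont `]a, c[ u -> t \in `]a, c[ -> ccvg (nbhs t) u (u t).
Proof.
move=> uac; rewrite in_itv/= => /andP[at_ tc].
have sub r s : a < r -> s < c -> `[r, s] `<=` `]a, c[.
  move=> ar sc z /=; rewrite !in_itv/= => /andP[rz zs].
  by rewrite (lt_le_trans ar)//= (le_lt_trans zs).
apply/ccvgP => e e0; have [d d0 H] := abs_cont_unif e0 uac.
near=> s.
have as_ : a < s by near: s; exact: lt_nbhsr.
have sc : s < c by near: s; exact: lt_nbhsl.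
have sd : `|t - s| < d by near: s; exact: (nbhsx_ballx t d d0).
have [st|/ltW ts] := leP s t.
  by rewrite normcB; apply: (H _ _ st (sub _ _ as_ tc)); exact: le_lt_trans (ler_norm _) sd.
by apply: (H _ _ ts (sub _ _ at_ sc)); rewrite distrC in sd; exact: le_lt_trans (ler_norm _) sd.
Unshelve. all: by end_near. Qed.

End abs_cont.

(** * Absolutely continuous functions with vanishing derivative *)

Section zero_derivative.
Context {R : realType}.
Implicit Types (u : R -> R[i]).

Lemma is_derive_near (f : R -> R) (t d e : R) : is_derive t 1 f d -> 0 < e ->
  \forall s \near t, `|f s - f t - d * (s - t)| <= e * `|s - t|.
Proof.
move=> /is_derive1_caratheodory[g [fg cg gt_]] e0.
have /cvgrPdist_lt/(_ e e0) := cg; apply: filterS => s; rewrite gt_ => ds.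
by rewrite fg -mulrBl normrM ler_wpM2r// distrC ltW.
Qed.

Lemma is_cderive_near0 u (t e : R) : is_cderive u t 0 -> 0 < e ->
  \forall s \near t, normc (u s - u t) <= e * `|s - t|.
Proof.
move=> /is_cderive_parts[dr di] e0.
have e2 : 0 < e / 2 by rewrite divr_gt0.
have Hr := is_derive_near dr e2; have Hi := is_derive_near di e2.
near=> s; apply: le_trans (normc_le_abs _) _.
rewrite !cReE !cImE (splitr e) mulrDl; apply: lerD.
  have : `|complex.Re (u s) - complex.Re (u t) - 0 * (s - t)| <= e / 2 * `|s - t|.
    by near: s.
  by rewrite mul0r subr0.
have : `|complex.Im (u s) - complex.Im (u t) - 0 * (s - t)| <= e / 2 * `|s - t|.
  by near: s.
by rewrite mul0r subr0.
Unshelve. all: by end_near. Qed.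

(* Finitely many successive intervals of [s, r], all contained in U, outside of
   which u varies at rate at most e. *)
Let covered (U : set R) u (e s r : R) := exists n (a b : nat -> R),
  [/\ forall i, (i < n)%N -> [/\ s <= a i, a i <= b i, b i <= r & `[a i, b i] `<=` U],
      forall i j, (i < j < n)%N -> b i <= a j &
      normc (u r - u s) <=
        e * (r - s) + \sum_(i < n) normc (u (b i) - u (a i))].

Let covered_refl U u e s : covered U u e s s.
Proof.
exists 0%N, (fun=> s), (fun=> s); split => [//|i j|]; first by rewrite ltn0 andbF.
by rewrite big_ord0 !subrr ComplexField.Normc.normc0 mulr0 addr0.
Qed.

Let covered_slow U u e s r r' : r <= r' -> normc (u r' - u r) <= e * (r' - r) ->
  covered U u e s r -> covered U u e s r'.
Proof.
move=> rr' ur [n [a [b [ab sep H]]]]; exists n, a, b; split=> //.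
  by move=> i /ab[? ? br ?]; split=> //; exact: le_trans br rr'.
rewrite (_ : u r' - u s = (u r' - u r) + (u r - u s)); last by ring.
apply: le_trans (le_normcD _ _) _; apply: le_trans (lerD ur H) _.
by rewrite addrA -mulrDr addrA subrK.
Qed.

Let covered_jump U u e s r r' : 0 <= e -> s <= r -> r <= r' -> `[r, r'] `<=` U ->
  covered U u e s r -> covered U u e s r'.
Proof.
move=> e0 sr rr' rU [n [a [b [ab sep H]]]].
exists n.+1, (fun i => if (i < n)%N then a i else r),
  (fun i => if (i < n)%N then b i else r'); split=> //.
- move=> i _; case: ifPn => [/ab[? ? br ?]|_]; last by split.
  by split=> //; exact: le_trans br rr'.
- move=> i j /andP[ij]; rewrite ltnS leq_eqVlt => /predU1P[jn|jn].
    by move: ij; rewrite jn ltnn => ij; rewrite ij; have [] := ab i ij.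
  by rewrite (ltn_trans ij jn) jn; apply: sep; rewrite ij.
rewrite big_ord_recr/= ltnn.
under eq_bigr do rewrite ltn_ord.
rewrite (_ : u r' - u s = (u r - u s) + (u r' - u r)); last by ring.
apply: le_trans (le_normcD _ _) _; rewrite addrA lerD2r.
by apply: le_trans H _; rewrite lerD2r ler_wpM2l// lerD2r.
Qed.

(* Induction along [s, t]: the supremum of the points where P holds satisfies P,
   and P then passes beyond it unless it is t. *)
Let cousin (P : R -> Prop) (s t : R) : s <= t -> P s ->
  (forall r, s <= r <= t -> exists2 d : R, 0 < d & forall p q, s <= p -> q <= t ->
     r - d < p -> p <= r -> r <= q -> q < r + d -> P p -> P q) -> P t.
Proof.
move=> st Ps step.
pose S := [set r | s <= r <= t /\ P r].
have Ss : S s by rewrite /S/= lexx st.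
have Sub : has_sup S.
  by split; [exists s|exists t => r /= [/andP[]]].
have sr : s <= sup S by exact: ub_le_sup (proj2 Sub) _ Ss.
have rt : sup S <= t by apply: ge_sup; [exists s|move=> r /= [/andP[]]].
have /step[d d0 H] : s <= sup S <= t by rewrite sr rt.
have [p [/andP[sp pt] Pp] dp] := sup_adherent d0 Sub.
have pS : p <= sup S by apply: ub_le_sup (proj2 Sub) _ _; split=> //; rewrite sp.
pose q := Num.min t (sup S + d / 2).
have rq : sup S <= q by rewrite le_min rt lerDl divr_ge0// ltW.
have qt : q <= t by rewrite ge_min lexx.
have qd : q < sup S + d by rewrite gt_min ltrD2l; apply/orP; right; lra.
have Pq : P q by exact: (H p q).
have : S q by rewrite /S/= qt (le_trans sr).
move=> /(ub_le_sup (proj2 Sub)); rewrite /q ge_min => /orP[tS|]; last lra.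
by have : t = q by [rewrite /q; case: leP; lra]; move=> ->.
Qed.

(** Cousin's argument.  The points where the derivative is not zero form a null
    set, which lies in an open set U so small that absolute continuity bounds the
    variation of u over disjoint intervals in U by e.  Around every other
    point u varies at rate at most e. *)
Lemma abs_cont_derive0 (a b : R) u : abs_cont `]a, b[ u ->
  {ae @lebesgue_measure R, forall t, t \in `]a, b[ -> is_cderive u t 0} ->
  forall s t, s \in `]a, b[ -> t \in `]a, b[ -> u s = u t.
Proof.
move=> uac [N [mN N0 Nsub]].
suff main s t : s <= t -> s \in `]a, b[ -> t \in `]a, b[ -> u s = u t.
  by move=> s t sab tab; have [|/ltW] := leP s t => st; [|apply/esym]; exact: main.
move=> st sab tab.
have stab : `[s, t] `<=` `]a, b[.
  move=> r /=; rewrite !in_itv/= => /andP[sr rt].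
  by rewrite (lt_le_trans _ sr) ?(itvP sab)// (le_lt_trans rt) ?(itvP tab).
apply/eqP; rewrite -subr_eq0 -normc_eq0 normcB; apply/eqP/le_anti.
rewrite normc_ge0 andbT; apply/ler_addgt0Pr => e' e'0; rewrite add0r.
(* The total is at most e (t - s) outside U and e inside U. *)
pose e := e' / (t - s + 1).
have ts1 : 0 < t - s + 1 by lra.
have e0 : 0 < e by rewrite divr_gt0.
have [d d0 uvar] := uac e e0.
have [|U [oU NU Ud]] := @lebesgue_regularity_outer _ N d mN _ d0.
  have h : (0%E < +oo :> \bar R)%E by exact: ltry.
  by rewrite -N0 in h.
have {}Ud : (lebesgue_measure U < d%:E)%E.
  have -> : lebesgue_measure U =
      (lebesgue_measure (U `\` N) + lebesgue_measure (U `&` N))%E.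
    by apply: measureDI => //; exact: open_measurable.
  have -> : lebesgue_measure (U `&` N) = 0%E; last by rewrite adde0.
  apply/eqP; rewrite -measure_le0; apply: le_trans (_ : lebesgue_measure N <= 0)%E.
    rewrite le_measure ?inE//; apply: measurableI => //; exact: open_measurable.
  by rewrite le_eqVlt; apply/orP; left; apply/eqP; exact: N0.
have /cousin : s <= t by []. 
move=> /(_ (covered U u e s) (covered_refl _ _ _ _)) [|n [p [q [pq sep H]]]].
  move=> r /andP[sr rt]; have rab : r \in `]a, b[ by apply: stab; rewrite /= in_itv/= sr.
  have [rN|rN] := pselect (N r).
    have : nbhs r U by apply: open_nbhs_nbhs; split=> //; exact: NU.
    move=> /nbhs_ballP[d1 /= d10 dU]; exists d1 => // p q sp qt rp pr rq qr.
    apply: covered_jump => //; [exact: ltW|exact: le_trans rq|].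
    move=> z /=; rewrite in_itv/= => /andP[pz zq]; apply: dU; rewrite /ball/=.
    by rewrite ltr_norml; apply/andP; split; lra.
  have u0 : is_cderive u r 0.
    by apply: contrapT => ur; apply/rN/Nsub => /= /(_ rab).
  have /nbhs_ballP[d1 /= d10 dU] := is_cderive_near0 u0 e0.
  exists d1 => // p q sp qt rp pr rq qr.
  apply: covered_slow; first exact: le_trans rq.
  rewrite (_ : u q - u p = (u q - u r) + (u r - u p)); last by ring.
  apply: le_trans (le_normcD _ _) _; rewrite (normcB (u r)).
  have /dU : ball r d1 q by rewrite /ball/= ltr_norml; apply/andP; split; lra.
  have /dU : ball r d1 p by rewrite /ball/= ltr_norml; apply/andP; split; lra.
  have -> : `|p - r| = r - p by rewrite distrC ger0_norm ?subr_ge0.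
  have -> : `|q - r| = q - r by rewrite ger0_norm ?subr_ge0.
  by move=> /= Hp Hq; lra.
have te : e * (t - s) + e <= e'.
  by rewrite /e -[X in _ + X]mulr1 -mulrDr divfK// gt_eqF.
apply: le_trans H _; apply: le_trans te; rewrite lerD2l ltW//.
have trivab : trivIset setT (fun i : 'I_n => `]p i, q i[%classic).
  have ord_disj (i j : 'I_n) : (i < j)%N -> `]p i, q i[ `&` `]p j, q j[ = set0.
    move=> ij; apply/seteqP; split => // z [] /=; rewrite !in_itv/= => /andP[_ zq].
    move=> /andP[pz _]; have := sep i j; rewrite ij ltn_ord => /(_ isT).
    by rewrite leNgt (lt_trans pz zq).
  apply/trivIsetP => i j _ _; rewrite -val_eqE neq_ltn => /orP[/ord_disj//|].
  by rewrite setIC; exact: ord_disj.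
rewrite (uvar n (fun i => p i) (fun i => q i))//.
  move=> i; have [sp pq_ qt _] := pq _ (ltn_ord i); split=> //.
  move=> z /=; rewrite in_itv/= => /andP[pz zq]; apply: stab; rewrite /= in_itv/=.
  by rewrite (le_trans sp)//= (le_trans zq).
rewrite -lte_fin; apply: le_lt_trans Ud.
rewrite (_ : _%:E = lebesgue_measure (\big[setU/set0]_(i < n) `]p i, q i[%classic)).
  apply: le_measure; rewrite ?inE.
  - by apply: bigsetU_measurable => i _; exact: measurable_itv.
  - exact: open_measurable.
  apply: (big_ind (fun A => A `<=` U)) => // [A B AU BU|i _].
    by rewrite subUset.
  have [_ _ _ pqU] := pq _ (ltn_ord i).
  by apply: subset_trans pqU; exact: subset_itv_oo_cc.
rewrite measure_bigsetU_ord// -sumEFin; apply: eq_bigr => i _.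
have [_ pi qi _] := pq _ (ltn_ord i).
by rewrite [RHS]lebesgue_measure_itv/= lte_fin; case: ltgtP pi => // ->; rewrite subrr.
Qed.
End zero_derivative.

(** * Mean value estimates and primitives *)

Section calculus.
Context {R : realType}.
Implicit Types (u v : R -> R[i]).

(** Compares g with a majorant H through the monotonicity of H - g and H + g. *)
Lemma mvt_le (g dg H dH : R -> R) (s t : R) : s <= t ->
  continuous g -> continuous H ->
  (forall r, r \in `]s, t[ -> is_derive r 1 g (dg r)) ->
  (forall r, r \in `]s, t[ -> is_derive r 1 H (dH r)) ->
  (forall r, r \in `]s, t[ -> `|dg r| <= dH r) ->
  `|g t - g s| <= H t - H s.
Proof.
move=> st cg cH ig iH dgH.
have mono (k dk : R -> R) : continuous k ->
    (forall r, r \in `]s, t[ -> is_derive r 1 k (dk r)) ->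
    (forall r, r \in `]s, t[ -> 0 <= dk r) -> k s <= k t.
  move=> ck ik k0.
  have [|c cst E] := MVT_segment st ik; first exact: continuous_subspaceT.
  have [st'|ts] := ltP s t; last by rewrite (_ : s = t)//; apply/le_anti; rewrite st.
  have [|c' cst' E'] := MVT st' ik; first exact: continuous_subspaceT.
  by rewrite -subr_ge0 E' mulr_ge0 ?k0// subr_ge0.
have A : (H - g) s <= (H - g) t.
  apply: (mono _ (fun r => dH r - dg r)).
  - by move=> r; apply: cvgB; [exact: cH|exact: cg].
  - by move=> r rst; apply: is_deriveB; [exact: iH|exact: ig].
  - by move=> r /dgH; rewrite subr_ge0; apply: le_trans; exact: ler_norm.
have B : (H + g) s <= (H + g) t.
  apply: (mono _ (fun r => dH r + dg r)).
  - by move=> r; apply: cvgD; [exact: cH|exact: cg].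
  - by move=> r rst; apply: is_deriveD; [exact: iH|exact: ig].
  - by move=> r /dgH; rewrite ler_norml => /andP[h _]; lra.
move: A B; rewrite !fctE => A B.
by rewrite ler_norml; apply/andP; split; lra.
Qed.

(** The factor 2 comes from estimating the two components separately. *)
Lemma cmvt_le u (du : R -> R[i]) (H dH : R -> R) (s t : R) : s <= t ->
  ccontinuous u -> continuous H ->
  (forall r, r \in `]s, t[ -> is_cderive u r (du r)) ->
  (forall r, r \in `]s, t[ -> is_derive r 1 H (dH r)) ->
  (forall r, r \in `]s, t[ -> normc (du r) <= dH r) ->
  normc (u t - u s) <= 2 * (H t - H s).
Proof.
move=> st cu cH iu iH duH.
apply: le_trans (normc_le_abs _) _; rewrite !cReE !cImE mulr_natl mulr2n.
apply: lerD.
  apply: (@mvt_le (fun r => complex.Re (u r)) (fun r => complex.Re (du r)) H dH) => //.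
  - exact: ccontinuous_Re.
  - by move=> r /iu/is_cderive_parts[].
  - by move=> r rst; exact: le_trans (abs_Re_normc _) (duH _ rst).
apply: (@mvt_le (fun r => complex.Im (u r)) (fun r => complex.Im (du r)) H dH) => //.
- exact: ccontinuous_Im.
- by move=> r /iu/is_cderive_parts[].
- by move=> r rst; exact: le_trans (abs_Im_normc _) (duH _ rst).
Qed.

Lemma cmvt_lipschitz u (du : R -> R[i]) (C s t : R) : s <= t ->
  ccontinuous u -> (forall r, r \in `]s, t[ -> is_cderive u r (du r)) ->
  (forall r, r \in `]s, t[ -> normc (du r) <= C) ->
  normc (u t - u s) <= 2 * (C * (t - s)).
Proof.
move=> st cu iu duC.
rewrite mulrBr; apply: (@cmvt_le u du (fun r => C * r) (fun=> C)) => //.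
- by move=> r; apply: cvgM; [exact: cvg_cst|exact: cvg_id].
- move=> r _; apply: (is_derive_eq (is_deriveZ C (is_derive_id r (1 : R)))).
  by rewrite /GRing.scale/= mulr1.
Qed.

(** By the mean value theorem, difference quotients at 0 are values of the
    derivative at intermediate points, in each component separately. *)
Lemma is_rderive_lim u (du : R -> R[i]) (r : R) (d : R[i]) : 0 < r ->
  ccontinuous u -> (forall t, t \in `]0, r[ -> is_cderive u t (du t)) ->
  ccvg 0^'+ du d -> is_rderive u 0 d.
Proof.
move=> r0 cu iu [dr di].
have main (g dg : R -> R) (l : R) : continuous g ->
    (forall t, t \in `]0, r[ -> is_derive t 1 g (dg t)) ->
    dg t @[t --> 0^'+] --> l -> h^-1 * (g h - g 0) @[h --> 0^'+] --> l.
  move=> cg ig /cvgrPdist_lt gl; apply/cvgrPdist_lt => e e0.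
  have /= := gl e e0; move=> [d1 /= d10 near1].
  near=> h.
  have h0 : 0 < h by near: h; exact: nbhs_right_gt.
  have hr : h < r by near: h; exact: nbhs_right_lt.
  have hd : h < d1 by near: h; exact: nbhs_right_lt.
  have igh t : t \in `]0, h[ -> is_derive t 1 g (dg t).
    by rewrite in_itv/= => /andP[t0 th]; apply: ig; rewrite in_itv/= t0 (lt_trans th).
  have [|c ch ->] := MVT h0 igh; first exact: continuous_subspaceT.
  rewrite subr0 mulrCA mulVf ?gt_eqF// mulr1.
  move: ch; rewrite in_itv/= => /andP[c0 ch]; apply: near1 => //.
  by rewrite /= sub0r normrN gtr0_norm// (lt_trans ch).
split; rewrite /rquotient.
  have := main _ _ _ (ccontinuous_Re cu) (fun t tr => proj1 ((is_cderive_parts _ _ _).1 (iu t tr))) dr.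
  apply: cvg_trans; apply: near_eq_cvg; near=> h.
  by rewrite add0r !cReE/= mul0r subr0.
have := main _ _ _ (ccontinuous_Im cu) (fun t tr => proj2 ((is_cderive_parts _ _ _).1 (iu t tr))) di.
apply: cvg_trans; apply: near_eq_cvg; near=> h.
by rewrite add0r !cImE/= mul0r addr0.
Unshelve. all: by end_near. Qed.

(** Composing with clamp b turns a function that is continuous on [0, b] into one
    that is continuous on R, so that the endpoints need no separate treatment. *)
Definition clamp (b t : R) := Num.max 0 (Num.min b t).

Lemma clamp_in b t : 0 < b -> clamp b t \in `[0, b].
Proof.
move=> b0; rewrite in_itv/= /clamp le_max lexx/= ge_max (ltW b0)/=.
by rewrite ge_min lexx.
Qed.

Lemma clamp_id b t : t \in `[0, b] -> clamp b t = t.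
Proof. by rewrite in_itv/= /clamp => /andP[t0 tb]; rewrite (min_r tb) max_r. Qed.

Lemma clamp_continuous b : continuous (clamp b).
Proof.
move=> t; apply: (@continuous_max _ _ (cst 0) (fun t => Num.min b t)).
  exact: cvg_cst.
by apply: (@continuous_min _ _ (cst b) id); [exact: cvg_cst|exact: cvg_id].
Qed.

Lemma continuous_clamp b (g : R -> R) : 0 < b ->
  {within `[0, b], continuous g} -> continuous (g \o clamp b).
Proof.
move=> b0 /subspace_continuousP cg t.
have /cg {}cg : `[0, b]%classic (clamp b t) by exact: clamp_in.
apply: (@cvg_comp _ _ _ _ _ _ (within `[0, b] (nbhs (clamp b t)))); last exact: cg.
move=> P; rewrite /within/= => nP.
suff : \forall s \near t, P (clamp b s) by [].
have : \forall s \near t, `[0, b]%classic (clamp b s) -> P (clamp b s).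
  exact: (@clamp_continuous b t _ nP).
by apply: filterS => s; apply; exact: clamp_in.
Qed.

Definition cprim (b : R) (G : R -> R[i]) (t : R) := cintegral `[0, clamp b t] G.

Let continuous_itv_integrable (g : R -> R) (s t : R) : continuous g ->
  lebesgue_measure.-integrable `[s, t] (EFin \o g).
Proof.
move=> cg; apply: continuous_compact_integrable; first exact: segment_compact.
exact: continuous_subspaceT.
Qed.

Lemma cprim0 b G : 0 < b -> cprim b G 0 = 0.
Proof.
move=> b0; rewrite /cprim clamp_id; last by rewrite in_itv/= lexx ltW.
by rewrite /cintegral !set_itv1 !Rintegral_set1.
Qed.

Lemma cprim_continuous b G : 0 < b -> ccontinuous G -> ccontinuous (cprim b G).
Proof.
move=> b0 cG t.
have main (g : R -> R) : continuous g ->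
    continuous (fun t => \int[lebesgue_measure]_(s in `[0, clamp b t]) g s).
  move=> cg; apply: (@continuous_clamp b
    (fun t => \int[lebesgue_measure]_(s in `[0, t]) g s)) => //.
  apply: parameterized_integral_continuous; first exact: ltW.
  exact: continuous_itv_integrable.
by split; apply: main; [exact: ccontinuous_Re|exact: ccontinuous_Im].
Qed.

Lemma is_cderive_cprim b G t : ccontinuous G -> t \in `]0, b[ ->
  is_cderive (cprim b G) t (G t).
Proof.
move=> cG; rewrite in_itv/= => /andP[t0 tb].
have main (g : R -> R) : continuous g ->
    is_derive t 1 (fun t => \int[lebesgue_measure]_(s in `[0, clamp b t]) g s) (g t).
  move=> cg.
  have [dF Fg] := continuous_FTC1_closed tb (@continuous_itv_integrable g 0 b cg) t0
    (cg t).
  have D : is_derive t (1 : R)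
      (fun t => \int[lebesgue_measure]_(s in `[0, t]) g s) (g t).
    by rewrite -Fg derive1E; exact/derivableP.
  apply: near_eq_is_derive D.
  near=> s; rewrite clamp_id// in_itv/=; apply/andP; split; apply: ltW; near: s.
    exact: lt_nbhsr.
  exact: lt_nbhsl.
by apply/is_cderive_parts; split; apply: main;
  [exact: ccontinuous_Re|exact: ccontinuous_Im].
Unshelve. all: by end_near. Qed.

Lemma abs_cont_ccontinuous (b : R) u : 0 < b -> abs_cont `[0, b] u ->
  ccontinuous (u \o clamp b).
Proof.
move=> b0 uac t; apply/ccvgP => e e0; have [d d0 H] := abs_cont_unif e0 uac.
have /cvgrPdist_lt/(_ d d0) := @clamp_continuous b t; apply: filterS => s ds.
have sub p q : `[clamp b p, clamp b q] `<=` `[0, b].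
  move=> r /=; rewrite !in_itv/= => /andP[pr rq].
  have := clamp_in p b0; have := clamp_in q b0; rewrite !in_itv/=.
  by move=> /andP[_ qb] /andP[p0 _]; rewrite (le_trans p0)//= (le_trans rq).
have [st|/ltW ts] /= := leP (clamp b s) (clamp b t).
  by rewrite normcB; apply: (H _ _ st (sub _ _)); exact: le_lt_trans (ler_norm _) ds.
apply: (H _ _ ts (sub _ _)); rewrite distrC in ds.
exact: le_lt_trans (ler_norm _) ds.
Qed.

Lemma itv_bounded (b : R) u : 0 < b -> ccontinuous u ->
  exists2 C : R, 0 <= C & forall t, t \in `[0, b] -> normc (u t) <= C.
Proof.
move=> b0 cu; have [|c _ H] := EVT_max (f := fun t => normc (u t)) (ltW b0).
  by apply: continuous_subspaceT; exact: ccontinuous_normc.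
by exists (normc (u c)); first exact: normc_ge0.
Qed.

End calculus.

(** * Normally convergent series *)

Section series.
Context {R : realType}.
Implicit Types (c : nat -> R) (a : nat -> R[i]).

Definition tail c (n : nat) : R := limn (series c) - series c n.

Lemma tail_cvg0 c : cvgn (series c) -> tail c n @[n --> \oo] --> (0 : R).
Proof.
by move=> cc; rewrite -[X in _ --> X](subrr (limn (series c))); apply: cvgB => //;
  exact: cvg_cst.
Qed.

Lemma normal_series_real c (r : nat -> R) : cvgn (series c) ->
  (forall k, `|r k| <= c k) ->
  cvgn (series r) /\ forall n, `|series r n - limn (series r)| <= tail c n.
Proof.
move=> cc rc.
have c0 k : 0 <= c k by apply: le_trans (rc k); exact: normr_ge0.
have cr : cvgn (series r).
  by apply: normed_cvg; apply: (series_le_cvg _ c0) => // n; exact: normr_ge0.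
split=> // n; rewrite distrC.
have lr : `|series r m - series r n| @[m --> \oo] --> `|limn (series r) - series r n|.
  by apply: cvg_norm; apply: cvgB => //; exact: cvg_cst.
have lc : series c m - series c n @[m --> \oo] --> tail c n.
  by apply: cvgB => //; exact: cvg_cst.
apply: (ler_cvg_to lr lc); near=> m.
have nm : (n <= m)%N by near: m; exact: nbhs_infty_ge.
rewrite !sub_series_geq//; apply: le_trans (ler_norm_sum _ _ _) _.
exact: ler_sum.
Unshelve. all: by end_near. Qed.

Lemma Re_partial_sum a n : complex.Re (\sum_(0 <= k < n) a k) =
  series (fun k => complex.Re (a k)) n.
Proof.
rewrite /series/=; elim/big_ind2 : _ => // x y z w <- <-; exact: cRe_add.
Qed.

Lemma Im_partial_sum a n : complex.Im (\sum_(0 <= k < n) a k) =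
  series (fun k => complex.Im (a k)) n.
Proof.
rewrite /series/=; elim/big_ind2 : _ => // x y z w <- <-; exact: cIm_add.
Qed.

(** The factor 2 comes from estimating the two components separately. *)
Lemma normal_csum c a n : cvgn (series c) -> (forall k, normc (a k) <= c k) ->
  normc (\sum_(0 <= k < n) a k - csum a) <= 2 * tail c n.
Proof.
move=> cc ac.
have [_ Hr] : cvgn (series (fun k => complex.Re (a k))) /\ _ :=
  normal_series_real cc (fun k => le_trans (abs_Re_normc _) (ac k)).
have [_ Hi] : cvgn (series (fun k => complex.Im (a k))) /\ _ :=
  normal_series_real cc (fun k => le_trans (abs_Im_normc _) (ac k)).
apply: le_trans (normc_le_abs _) _.
rewrite !cReE !cImE Re_partial_sum Im_partial_sum mulr_natl mulr2n.
by apply: lerD; [exact: Hr|exact: Hi].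
Qed.

Lemma csum_unique a (l : R[i]) :
  (forall e : R, 0 < e ->
    \forall n \near \oo, normc (\sum_(0 <= k < n) a k - l) < e) ->
  csum a = l.
Proof.
move=> al; apply: complex_eq; apply: cvg_lim => //; apply/cvgrPdist_lt => e e0.
  apply: filterS (al e e0) => n; apply: le_lt_trans.
  by rewrite distrC -Re_partial_sum -cRe_opp -cRe_add; exact: abs_Re_normc.
apply: filterS (al e e0) => n; apply: le_lt_trans.
by rewrite distrC -Im_partial_sum -cIm_opp -cIm_add; exact: abs_Im_normc.
Qed.

Lemma tail_near c (C e : R) : cvgn (series c) -> 0 <= C -> 0 < e ->
  \forall n \near \oo, C * tail c n < e.
Proof.
move=> cc C0 e0.
have : C * tail c n @[n --> \oo] --> C * 0 by apply: cvgM; [exact: cvg_cst|exact: tail_cvg0].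
rewrite mulr0 => /cvgrPdist_lt/(_ e e0); apply: filterS => n.
by rewrite sub0r normrN; apply: le_lt_trans; exact: ler_norm.
Qed.

Lemma csumZ c a (l : R[i]) : cvgn (series c) -> (forall k, normc (a k) <= c k) ->
  csum (fun k => l * a k) = l * csum a.
Proof.
move=> cc ac; apply: csum_unique => e e0.
have := @tail_near c (normc l * 2) e cc.
rewrite mulr_ge0 ?normc_ge0//= => /(_ isT e0); apply: filterS => n.
apply: le_lt_trans; rewrite -mulr_sumr -mulrBr normcM -mulrA.
by rewrite ler_wpM2l ?normc_ge0//; exact: normal_csum.
Qed.

Lemma csumD (c : nat -> R) (a a' : nat -> R[i]) : cvgn (series c) ->
  (forall k, normc (a k) <= c k) -> (forall k, normc (a' k) <= c k) ->
  csum (fun k => a k + a' k) = csum a + csum a'.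
Proof.
move=> cc ac ac'; apply: csum_unique => e e0.
have := tail_near cc (ler0n R 4) e0; apply: filterS => n; apply: le_lt_trans.
rewrite big_split/= opprD addrACA; apply: le_trans (le_normcD _ _) _.
have := normal_csum n cc ac; have := normal_csum n cc ac'; lra.
Qed.

Lemma csum_shift c a (l : R[i]) : cvgn (series c) -> (forall k, normc (a k) <= c k) ->
  csum (fun k => if k is k'.+1 then l * a k' else 0) = l * csum a.
Proof.
move=> cc ac; apply: csum_unique => e e0.
have := @tail_near c (normc l * 2) e cc.
rewrite mulr_ge0 ?normc_ge0//= => /(_ isT e0) H.
have [n0 _ {}H] := H; exists n0.+1 => // -[//|n] /= n0n.
rewrite big_nat_recl//= add0r -mulr_sumr -mulrBr normcM.
apply: le_lt_trans (H n n0n); rewrite -mulrA.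
by rewrite ler_wpM2l ?normc_ge0//; exact: normal_csum.
Qed.

Lemma is_cvg_series_shift c : cvgn (series c) ->
  cvgn (series (fun k => if k is k'.+1 then c k' else 0)).
Proof.
move=> cc; apply/cvg_ex; exists (limn (series c)); rewrite -cvg_shiftS /=.
rewrite (_ : (fun n => _) = series c)//; apply/funext => n.
by rewrite seriesEnat/= big_nat_recl//= add0r seriesEnat.
Qed.

Lemma csum_head a : (forall k, a k.+1 = 0) -> csum a = a 0%N.
Proof.
move=> a0; apply: csum_unique => e e0; exists 1%N => // -[//|n] _ /=.
by rewrite big_nat_recl//= big1 ?addr0 ?subrr ?ComplexField.Normc.normc0.
Qed.

Implicit Types u v : nat -> R -> R[i].

Lemma csum_continuous c u : cvgn (series c) -> (forall k t, normc (u k t) <= c k) ->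
  (forall k, ccontinuous (u k)) -> ccontinuous (fun t => csum (u^~ t)).
Proof.
move=> cc uc cu t; apply/ccvgP => e e0.
have e3 : 0 < e / 3 by rewrite divr_gt0.
have [n0 _ /(_ n0 (leqnn _)) Hn] := @tail_near c 2 (e / 3) cc (ler0n _ 2) e3.
have cS : ccontinuous (fun t => \sum_(0 <= k < n0) u k t).
  elim: n0 {Hn} => [|n IH].
    by rewrite (_ : (fun t => _) = fun=> 0); [exact: ccontinuous_cst|
      apply/funext => s; rewrite big_nil].
  rewrite (_ : (fun t => _) = (fun t => \sum_(0 <= k < n) u k t + u n t)).
    exact: ccontinuousD.
  by apply/funext => s; rewrite big_nat_recr.
have /ccvgP/(_ _ e3) := cS t; apply: filterS => s Hs.
rewrite (_ : csum _ - _ = - (\sum_(0 <= k < n0) u k s - csum (u^~ s)) +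
  ((\sum_(0 <= k < n0) u k s - \sum_(0 <= k < n0) u k t) +
   (\sum_(0 <= k < n0) u k t - csum (u^~ t)))); last by ring.
apply: le_lt_trans (le_normcD _ _) _; rewrite normcN.
have Ht r : normc (\sum_(0 <= k < n0) u k r - csum (u^~ r)) < e / 3.
  by apply: le_lt_trans Hn; exact: normal_csum.
have := Ht s; have := Ht t.
have := le_normcD (\sum_(0 <= k < n0) u k s - \sum_(0 <= k < n0) u k t)
  (\sum_(0 <= k < n0) u k t - csum (u^~ t)).
lra.
Qed.

(** Termwise differentiation: the partial sums of u minus the primitive of
    the sum of the derivatives have uniformly small derivative, so in the limit
    that difference is constant. *)
Lemma is_cderive_csum (b : R) c u v : 0 < b -> cvgn (series c) ->
  (forall k t, normc (u k t) <= c k) -> (forall k t, normc (v k t) <= c k) ->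
  (forall k, ccontinuous (u k)) -> (forall k, ccontinuous (v k)) ->
  (forall k t, t \in `]0, b[ -> is_cderive (u k) t (v k t)) ->
  forall t, t \in `]0, b[ -> is_cderive (fun t => csum (u^~ t)) t (csum (v^~ t)).
Proof.
move=> b0 cc uc vc cu cv uv.
pose V t := csum (v^~ t); have cV : ccontinuous V by exact: csum_continuous cc vc cv.
pose D n t := \sum_(0 <= k < n) u k t - cprim b V t.
have cD n : ccontinuous (D n).
  move=> t; apply: ccvgB; last exact: cprim_continuous.
  elim: n => [|n IH].
    apply: (@ccvg_near _ _ _ (fun=> 0)); last by rewrite big_nil; exact: ccvg_cst.
    by apply: nearW => s; rewrite big_nil.
  apply: (@ccvg_near _ _ _ (fun t => \sum_(0 <= k < n) u k t + u n t)).
    by apply: nearW => s; rewrite big_nat_recr.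
  rewrite big_nat_recr//=; apply: ccvgD; [exact: IH|exact: cu].
have dD n t : t \in `]0, b[ -> is_cderive (D n) t (\sum_(0 <= k < n) v k t - V t).
  move=> tb; apply: is_cderiveB; last exact: is_cderive_cprim.
  elim: n => [|n IH].
    rewrite big_nil; apply: (@is_cderive_ext _ (fun=> 0)); last exact: is_cderive_cst.
    by move=> s; rewrite big_nil.
  apply: (@is_cderive_ext _ (fun t => \sum_(0 <= k < n) u k t + u n t)).
    by move=> s; rewrite big_nat_recr.
  rewrite big_nat_recr//=; apply: is_cderiveD; [exact: IH|exact: uv].
have key t : t \in `[0, b] -> csum (u^~ t) = csum (u^~ 0) + cprim b V t.
  rewrite in_itv/= => /andP[t0 tb].
  apply: csum_unique => e e0.
  have C0 : 0 <= 2 + 4 * b by rewrite addr_ge0// mulr_ge0// ltW.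
  have := tail_near cc C0 e0; apply: filterS => n; apply: le_lt_trans.
  rewrite (_ : _ - _ = (D n t - D n 0) + (\sum_(0 <= k < n) u k 0 - csum (u^~ 0))).
    apply: le_trans (le_normcD _ _) _; rewrite mulrDl addrC; apply: lerD.
      exact: normal_csum.
    apply: le_trans (_ : 2 * (2 * tail c n * (t - 0)) <= _).
      apply: (cmvt_lipschitz t0 (cD n)) => r.
        by rewrite in_itv/= => /andP[r0 rt]; apply: dD; rewrite in_itv/= r0 (lt_le_trans rt).
      by move=> _; exact: normal_csum.
    have : 0 <= tail c n.
      by rewrite -(pmulr_rge0 _ (ltr0n _ 2)); apply: le_trans (normal_csum n cc (uc^~ 0)); exact: normc_ge0.
    by rewrite subr0; nra.
  by rewrite /D cprim0//; ring.
move=> t tb; apply: (@is_cderive_near _ (fun t => csum (u^~ 0) + cprim b V t)).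
  move: tb; rewrite in_itv/= => /andP[t0 tb].
  near=> s; rewrite -key// in_itv/=; apply/andP; split; apply: ltW; near: s.
    exact: lt_nbhsr.
  exact: lt_nbhsl.
have := is_cderiveD (is_cderive_cst (csum (u^~ 0)) t) (is_cderive_cprim cV tb).
by rewrite add0r.
Unshelve. all: by end_near. Qed.

Lemma normal_abs_unif_cvg (T : Type) (A : set T) (c : nat -> R)
    (t : nat -> T -> R[i]) (s : T -> R[i]) : cvgn (series c) ->
  (forall y k, A y -> normc (t k y) <= c k) ->
  (forall y, A y -> s y = csum (t^~ y)) -> abs_unif_cvg A t s.
Proof.
move=> cc tc st; split=> [y Ay|e e0].
  apply: (series_le_cvg _ _ _ cc) => k; rewrite ?normc_ge0 ?tc//.
  by apply: le_trans (tc y k Ay); exact: normc_ge0.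
have := tail_near cc (ler0n R 2) e0; apply: filterS => n Hn y Ay.
by apply: le_lt_trans Hn; rewrite st//; apply: normal_csum => // k; exact: tc.
Qed.

End series.

(** * Iterated integrals of F^2 and F^-2 *)

Section formal_powers.
Context {R : realType}.
Variables (b : R) (F : R -> R[i]).
Hypotheses (b0 : 0 < b) (cF : ccontinuous F) (F0 : forall t, F t != 0)
  (F_clamp : forall t, F (clamp b t) = F t).

Lemma clamp_bounded (u : R -> R[i]) : ccontinuous u ->
  (forall t, u (clamp b t) = u t) -> exists2 C : R, 0 <= C & forall t, normc (u t) <= C.
Proof.
move=> cu uE; have [C C0 HC] := itv_bounded b0 cu.
by exists C => // t; rewrite -uE; apply: HC; exact: clamp_in.
Qed.

Definition weight (m : nat) (s : R) : R[i] := (F s ^+ 2) ^ ((-1 : int) ^+ m).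

Lemma weight_even m s : ~~ odd m -> weight m s = F s * F s.
Proof. by move=> me; rewrite /weight -signr_odd (negbTE me) expr0 expr1z expr2. Qed.

Lemma weight_odd m s : odd m -> weight m s = (F s)^-1 * (F s)^-1.
Proof.
by move=> mo; rewrite /weight -signr_odd mo expr1 exprN1 -invfM expr2.
Qed.

Lemma weight_continuous m : ccontinuous (weight m).
Proof.
case: (boolP (odd m)) => mo.
  rewrite (_ : weight m = fun s => (F s)^-1 * (F s)^-1); last first.
    by apply/funext => s; exact: weight_odd.
  by apply: ccontinuousM; exact: ccontinuousV.
rewrite (_ : weight m = fun s => F s * F s); first exact: ccontinuousM.
by apply/funext => s; exact: weight_even.
Qed.

Lemma weight_bounded : exists2 M : R, 0 <= M & forall m t, normc (weight m t) <= M.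
Proof.
have E m : exists2 C : R, 0 <= C & forall t, normc (weight m t) <= C.
  apply: clamp_bounded; first exact: weight_continuous.
  by move=> t; rewrite /weight F_clamp.
have [C C0 HC] := E 0%N; have [C' C'0 HC'] := E 1%N.
exists (C + C'); first exact: addr_ge0.
move=> m t; case: (boolP (odd m)) => mo.
  by rewrite weight_odd// -(@weight_odd 1)// ler_wpDl.
by rewrite weight_even// -(@weight_even 0)// ler_wpDr.
Qed.

(** The formal powers divided by the factorial of their index: i = 0 gives the
    family Xtilde and i = 1 the family Xpow. *)
Fixpoint iterint (i m : nat) : R -> R[i] :=
  if m is m'.+1 then cprim b (fun s => iterint i m' s * weight (m' + i) s)
  else fun=> 1.

Lemma iterint_continuous i m : ccontinuous (iterint i m).
Proof.
elim: m => [|m IH] /=; first exact: ccontinuous_cst.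
by apply: cprim_continuous => //; apply: ccontinuousM => //; exact: weight_continuous.
Qed.

Lemma is_cderive_iterint i m t : t \in `]0, b[ ->
  is_cderive (iterint i m.+1) t (iterint i m t * weight (m + i) t).
Proof.
move=> tb; apply: (@is_cderive_cprim _ b (fun s => iterint i m s * weight (m + i) s)) => //.
by apply: ccontinuousM; [exact: iterint_continuous|exact: weight_continuous].
Qed.

Lemma iterint_clamp i m t : iterint i m (clamp b t) = iterint i m t.
Proof. by case: m => //= m; rewrite /cprim clamp_id//; exact: clamp_in. Qed.

Lemma iterint0 i m : iterint i m.+1 0 = 0.
Proof. exact: cprim0. Qed.

(** The derivative of order m + 1 is at most M times the bound of order m, whose
    primitive is, up to the factor 2 of cmvt_le, the bound of order m + 1. *)
Lemma iterint_le (M : R) : (forall m t, normc (weight m t) <= M) ->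
  forall i m t, normc (iterint i m t) <= (2 * M * b) ^+ m / m`!%:R.
Proof.
move=> HM i m t; rewrite -iterint_clamp.
have M0 : 0 <= M by apply: le_trans (HM 0%N 0); exact: normc_ge0.
have main s : s \in `[0, b] -> normc (iterint i m s) <= (2 * M * s) ^+ m / m`!%:R.
  elim: m s => [|m IH] s sb; first by rewrite expr0 fact0 divr1 ComplexField.Normc.normc1.
  have [s0 sb'] : 0 <= s /\ s <= b by rewrite !(itvP sb).
  rewrite -[iterint _ _ _]subr0 -(iterint0 i m).
  pose C := (2 * M) ^+ m * M / m`!%:R.
  pose H (r : R) := C / m.+1%:R * r ^+ m.+1.
  apply: le_trans (_ : 2 * (H s - H 0) <= _).
    apply: (@cmvt_le _ _ (fun r => iterint i m r * weight (m + i) r) _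
      (fun r => C * r ^+ m)); first exact: s0.
    - exact: iterint_continuous.
    - by move=> r; apply: cvgM; [exact: cvg_cst|exact: exprn_continuous].
    - by move=> r rs; apply: is_cderive_iterint; rewrite in_itv/= (itvP rs)/=
        (lt_le_trans _ sb')// (itvP rs).
    - move=> r rs.
      have D := is_deriveZ (C / m.+1%:R) (is_deriveX m.+1 (is_derive_id r (1 : R))).
      have -> : H = (C / m.+1%:R) \*: (id ^+ m.+1).
        by apply/funext => z; rewrite /H /= exprfctE.
      apply: (is_derive_eq D); rewrite /GRing.scale /= mulr1 mulrA divfK//.
    - move=> r rs; rewrite normcM /C.
      rewrite (_ : _ * r ^+ m = (2 * M * r) ^+ m / m`!%:R * M); last first.
        by rewrite !exprMn; ring.
      apply: ler_pM; rewrite ?normc_ge0//.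
      by apply: IH; rewrite in_itv/= !(itvP rs)/= (le_trans _ sb')// (itvP rs).
  rewrite /H expr0n/= mulr0 subr0 /C factS natrM !exprMn !exprS.
  have : (m`!%:R : R) != 0 by rewrite pnatr_eq0 -lt0n fact_gt0.
  have : (m.+1%:R : R) != 0 by rewrite pnatr_eq0.
  move: (m.+1%:R : R) (m`!%:R : R) => p q p0 q0.
  by rewrite le_eqVlt; apply/orP; left; apply/eqP; field; rewrite q0.
apply: le_trans (main _ (clamp_in _ b0)) _.
rewrite ler_wpM2r ?invr_ge0// lerXn2r ?nnegrE ?mulr_ge0//; first last.
- by rewrite ler_wpM2l ?mulr_ge0// (itvP (clamp_in _ b0)).
- exact: ltW.
by rewrite (itvP (clamp_in _ b0)).
Qed.

(** The term of index k of the series u_i is F times iter_y i rho k.  Lowering by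
    one the order of the iterated integral gives iter_z i rho k, so that the two
    families satisfy y' = F^-2 z and z' = - rho^2 F^2 y up to a shift of k. *)
Definition iter_y (i : nat) (rho : R[i]) (k : nat) (t : R) : R[i] :=
  (- rho ^+ 2) ^+ k * iterint i (2 * k + i) t.

Definition iter_z (i : nat) (rho : R[i]) (k : nat) (t : R) : R[i] :=
  (- rho ^+ 2) ^+ k * (if (2 * k + i)%N is m.+1 then iterint i m t else 0).

Definition sum_y i rho t := csum (fun k => iter_y i rho k t).
Definition sum_z i rho t := csum (fun k => iter_z i rho k t).

Lemma iter_y_continuous i rho k : ccontinuous (iter_y i rho k).
Proof. by apply: ccontinuousM; [exact: ccontinuous_cst|exact: iterint_continuous]. Qed.

Lemma iter_z_continuous i rho k : ccontinuous (iter_z i rho k).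
Proof.
apply: ccontinuousM; first exact: ccontinuous_cst.
by case: (2 * k + i)%N => [|m]; [exact: ccontinuous_cst|exact: iterint_continuous].
Qed.

Lemma is_cderive_iter_y i rho k t : t \in `]0, b[ ->
  is_cderive (iter_y i rho k) t ((F t)^-1 * (F t)^-1 * iter_z i rho k t).
Proof.
move=> tb; rewrite /iter_y /iter_z mulrCA; apply: is_cderiveZ.
case E : (2 * k + i)%N => [|m]; first by rewrite mulr0; exact: is_cderive_cst.
rewrite mulrC -(@weight_odd (m + i)); first exact: is_cderive_iterint.
have : (m + i).+1 = (2 * (k + i))%N by rewrite -addSn -E; lia.
by move=> /(congr1 odd); rewrite mul2n odd_double /= => /negbFE.
Qed.

Lemma is_cderive_iter_z i rho k t : (i <= 1)%N -> t \in `]0, b[ ->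
  is_cderive (iter_z i rho k) t
    (if k is k'.+1 then - rho ^+ 2 * (F t * F t) * iter_y i rho k' t else 0).
Proof.
move=> i1 tb; case: k => [|k].
  by case: i i1 => [|[|]]// _; rewrite -[X in is_cderive _ _ X](mulr0 ((- rho ^+ 2) ^+ 0));
    apply: is_cderiveZ; exact: is_cderive_cst.
rewrite /iter_z /iter_y (_ : (2 * k.+1 + i = (2 * k + i).+2)%N); last by lia.
rewrite (_ : _ * (_ * _) = (- rho ^+ 2) ^+ k.+1 * (iterint i (2 * k + i) t * (F t * F t))).
  apply: is_cderiveZ; rewrite -(@weight_even (2 * k + i + i)).
    exact: is_cderive_iterint.
  by rewrite -addnA addnn mul2n oddD !odd_double.
by rewrite [X in _ = X * _]exprS; ring.
Qed.

(** The orders 2 k + i and 2 k + i - 1 lie between k and 2 k + 1 unless the second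
    is -1, when iter_z vanishes.  So the factorial is at least k! and, as A >= 1,
    the power of A at most A^(2 k + 1). *)
Lemma iter_bound : exists2 A : R, 1 <= A & forall (P : R) i rho k t, (i <= 1)%N ->
  1 <= P -> normc rho <= P ->
  normc (iter_y i rho k t) <= A * exp_coeff ((P * A) ^+ 2) k /\
  normc (iter_z i rho k t) <= A * exp_coeff ((P * A) ^+ 2) k.
Proof.
have [M M0 HM] := weight_bounded.
pose A := 2 * M * b + 1.
have B0 : 0 <= 2 * M * b by rewrite !mulr_ge0// ltW.
have A1 : 1 <= A by rewrite /A lerDr.
have A0 : 0 <= A by exact: le_trans A1.
exists A => // P i rho k t i1 P1 rhoP.
have it m : normc (iterint i m t) <= A ^+ m / m`!%:R.
  apply: le_trans (iterint_le HM i m t) _.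
  by rewrite ler_wpM2r ?invr_ge0// lerXn2r ?nnegrE// /A lerDl.
have main m : (k <= m <= 2 * k + 1)%N ->
    normc ((- rho ^+ 2) ^+ k * iterint i m t) <= A * exp_coeff ((P * A) ^+ 2) k.
  move=> /andP[km mk]; rewrite normcM normcX normcN normcX /exp_coeff/=.
  rewrite -!exprM exprMn.
  have -> : A * (P ^+ (2 * k) * A ^+ (2 * k) / k`!%:R) =
      P ^+ (2 * k) * (A ^+ (2 * k + 1) / k`!%:R) by rewrite addn1 exprS; ring.
  apply: ler_pM; rewrite ?exprn_ge0 ?normc_ge0//.
    by rewrite lerXn2r ?nnegrE ?normc_ge0// (le_trans _ P1).
  apply: le_trans (it m) _; apply: ler_pM; rewrite ?invr_ge0 ?exprn_ge0//.
    by rewrite ler_weXn2l.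
  by rewrite lef_pV2 ?posrE ?ltr0n ?fact_gt0// ler_nat leq_fact.
split; first by apply: main; lia.
rewrite /iter_z; case E : (2 * k + i)%N => [|m]; last by apply: main; lia.
rewrite mulr0 ComplexField.Normc.normc0 mulr_ge0// /exp_coeff divr_ge0 ?exprn_ge0//.
by rewrite mulr_ge0// (le_trans _ P1).
Qed.

Lemma exp_coeff_cvg (A B : R) : cvgn (series (fun k => A * exp_coeff B k)).
Proof. by apply: is_cvg_seriesZ; exact: is_cvg_series_exp_coeff. Qed.

End formal_powers.

(** * The formal powers as iterated integrals *)

Section spps_iter.
Context {R : realType}.
Variables (b : R) (f : R -> R[i]).
Let F := f \o clamp b.
Hypotheses (b0 : 0 < b) (cF : ccontinuous F) (F0 : forall t, F t != 0).

Lemma clamp_clamp (u : R -> R[i]) t : (u \o clamp b) (clamp b t) = (u \o clamp b) t.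
Proof. by rewrite /= clamp_id//; exact: clamp_in. Qed.

Lemma cRe_nat_mul n (z : R[i]) : complex.Re (n%:R * z) = n%:R * complex.Re z.
Proof.
by rewrite -(rmorph_nat (real_complex R)) cReE/= mul0r subr0.
Qed.

Lemma cIm_nat_mul n (z : R[i]) : complex.Im (n%:R * z) = n%:R * complex.Im z.
Proof.
by rewrite -(rmorph_nat (real_complex R)) cImE/= mul0r addr0.
Qed.

Lemma cintegral_cprim n (g G : R -> R[i]) t : ccontinuous G ->
  (forall s, s \in `[0, b] -> g s = n%:R * G s) -> t \in `[0, b] ->
  cintegral `[0, t] g = n%:R * cprim b G t.
Proof.
move=> cG gG tb; rewrite /cprim clamp_id//.
have sub s : s \in `[0, t]%classic -> s \in `[0, b].
  rewrite inE/= !in_itv/= => /andP[-> st]/=; apply: le_trans st _.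
  by rewrite (itvP tb).
have int (h : R -> R) : continuous h ->
    lebesgue_measure.-integrable `[0, t] (EFin \o h).
  move=> ch; apply: continuous_compact_integrable; first exact: segment_compact.
  exact: continuous_subspaceT.
apply: complex_eq; rewrite /cintegral (cRe_nat_mul, cIm_nat_mul) /=.
  rewrite -RintegralZl//; last exact/int/ccontinuous_Re.
  by apply: eq_Rintegral => s st; rewrite gG ?sub// cRe_nat_mul.
rewrite -RintegralZl//; last exact/int/ccontinuous_Im.
by apply: eq_Rintegral => s st; rewrite gG ?sub// cIm_nat_mul.
Qed.

Let integrand_continuous i m :
  ccontinuous (fun s => iterint b F i m s * weight F (m + i) s).
Proof.
by apply: ccontinuousM; [exact: iterint_continuous|exact: weight_continuous].
Qed.

Lemma Xtilde_iterint m t : t \in `[0, b] ->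
  Xtilde f m t = m`!%:R * iterint b F 0 m t.
Proof.
elim: m t => [|m IH] t tb /=; first by rewrite fact0 mulr1.
rewrite factS natrM -mulrA; congr (_ * _).
apply: (@cintegral_cprim m`! _ (fun s => iterint b F 0 m s * weight F (m + 0) s)) => //.
by move=> s sb; rewrite IH// mulrA addn0 /weight /F /= clamp_id.
Qed.

Lemma Xpow_iterint m t : t \in `[0, b] ->
  Xpow f m t = m`!%:R * iterint b F 1 m t.
Proof.
elim: m t => [|m IH] t tb /=; first by rewrite fact0 mulr1.
rewrite factS natrM -mulrA; congr (_ * _).
apply: (@cintegral_cprim m`! _ (fun s => iterint b F 1 m s * weight F (m + 1) s)) => //.
by move=> s sb; rewrite IH// mulrA addn1 /weight /F /= clamp_id.
Qed.

Lemma spps_term_iter i rho k t : (i <= 1)%N -> t \in `[0, b] ->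
  spps_term f i rho k t = F t * iter_y b F i rho k t.
Proof.
move=> i1 tb; rewrite /spps_term /phi /iter_y /F /= clamp_id// -/F.
have fact0 : ((2 * k + i)`!%:R : R[i]) != 0 by rewrite pnatr_eq0 -lt0n fact_gt0.
have -> : (-1) ^+ k * rho ^+ (2 * k) = (- rho ^+ 2) ^+ k.
  by rewrite exprM -exprMn mulN1r.
rewrite oddD mul2n odd_double /= -mul2n.
by case: i i1 fact0 => [|[|//]] _ fact0 /=; rewrite (Xtilde_iterint, Xpow_iterint)//;
  field.
Qed.

Lemma iter_majorant (P : R) i : (i <= 1)%N -> exists2 c : nat -> R,
  cvgn (series c) /\ (forall k, 0 <= c k) &
  forall rho k t, normc rho <= P ->
    normc (iter_y b F i rho k t) <= c k /\ normc (iter_z b F i rho k t) <= c k.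
Proof.
move=> i1; have [A A1 HA] := iter_bound b0 cF F0 (clamp_clamp f).
exists (fun k => A * exp_coeff (((1 + `|P|) * A) ^+ 2) k).
  split=> [|k]; first exact: exp_coeff_cvg.
  rewrite mulr_ge0 ?(le_trans _ A1)// /exp_coeff divr_ge0// exprn_ge0//.
  by rewrite sqr_ge0.
move=> rho k t rP; apply: HA => //; first by rewrite lerDl.
by apply: le_trans rP _; rewrite ler_wpDl// ler_norm.
Qed.

Lemma spps_sum_y i rho t : (i <= 1)%N -> t \in `[0, b] ->
  spps f i rho t = F t * sum_y b F i rho t.
Proof.
move=> i1 tb; have [c [cc c0] Hc] := iter_majorant (normc rho) i1.
rewrite /spps /sum_y -(csumZ _ cc); last by move=> k; have [] := Hc rho k t (lexx _).
by congr csum; apply/funext => k; exact: spps_term_iter.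
Qed.

Lemma sum_y_continuous i rho : (i <= 1)%N -> ccontinuous (sum_y b F i rho).
Proof.
move=> i1; have [c [cc c0] Hc] := iter_majorant (normc rho) i1.
apply: (csum_continuous cc) => k; last exact: iter_y_continuous.
by move=> t; have [] := Hc rho k t (lexx _).
Qed.

Lemma sum_z_continuous i rho : (i <= 1)%N -> ccontinuous (sum_z b F i rho).
Proof.
move=> i1; have [c [cc c0] Hc] := iter_majorant (normc rho) i1.
apply: (csum_continuous cc) => k; last exact: iter_z_continuous.
by move=> t; have [] := Hc rho k t (lexx _).
Qed.

Lemma is_cderive_sum_y i rho t : (i <= 1)%N -> t \in `]0, b[ ->
  is_cderive (sum_y b F i rho) t ((F t)^-1 * (F t)^-1 * sum_z b F i rho t).
Proof.
move=> i1 tb; have [c [cc c0] Hc] := iter_majorant (normc rho) i1.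
have [M M0 HM] := weight_bounded b0 cF F0 (clamp_clamp f).
have cc' : cvgn (series (fun k => (1 + M) * c k)) by exact: is_cvg_seriesZ.
rewrite -(csumZ _ cc); last by move=> k; have [] := Hc rho k t (lexx _).
apply: (is_cderive_csum b0 cc' (u := iter_y b F i rho)
  (v := fun k t => (F t)^-1 * (F t)^-1 * iter_z b F i rho k t)) => //.
- move=> k s; have [hy _] := Hc rho k s (lexx _); apply: le_trans hy _.
  by rewrite mulrDl mul1r lerDl mulr_ge0.
- move=> k s; have [_ hz] := Hc rho k s (lexx _).
  rewrite normcM -(@weight_odd _ F 1)// mulrDl mul1r ler_wpDl//.
  by apply: ler_pM; rewrite ?normc_ge0.
- by move=> k; exact: iter_y_continuous.
- move=> k; apply: ccontinuousM; last exact: iter_z_continuous.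
  by apply: ccontinuousM; exact: ccontinuousV.
- by move=> k s sb; exact: is_cderive_iter_y.
Qed.

Lemma is_cderive_sum_z i rho t : (i <= 1)%N -> t \in `]0, b[ ->
  is_cderive (sum_z b F i rho) t (- rho ^+ 2 * (F t * F t) * sum_y b F i rho t).
Proof.
move=> i1 tb; have [c [cc c0] Hc] := iter_majorant (normc rho) i1.
have [M M0 HM] := weight_bounded b0 cF F0 (clamp_clamp f).
rewrite -(csum_shift _ cc); last by move=> k; have [] := Hc rho k t (lexx _).
pose L := normc rho ^+ 2 * M.
have L0 : 0 <= L by rewrite mulr_ge0 ?exprn_ge0 ?normc_ge0.
pose c' k := c k + L * (if k is k'.+1 then c k' else 0).
have cc' : cvgn (series c').
  by apply: is_cvg_seriesD => //; apply: is_cvg_seriesZ; exact: is_cvg_series_shift.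
apply: (is_cderive_csum b0 cc' (u := iter_z b F i rho)
  (v := fun k t => if k is k'.+1
     then - rho ^+ 2 * (F t * F t) * iter_y b F i rho k' t else 0)) => //.
- move=> k s; have [_ hz] := Hc rho k s (lexx _); apply: le_trans hz _.
  by rewrite /c' lerDl mulr_ge0//; case: k.
- move=> [|k] s; first by rewrite ComplexField.Normc.normc0 /c' mulr0 addr0.
  have [hy _] := Hc rho k s (lexx _).
  rewrite /c' ler_wpDl// normcM; apply: ler_pM; rewrite ?normc_ge0//.
  rewrite normcM normcN normcX /L ler_wpM2l ?exprn_ge0 ?normc_ge0//.
  by rewrite -(@weight_even _ F 0).
- by move=> k; exact: iter_z_continuous.
- move=> [|k]; first exact: ccontinuous_cst.
  apply: ccontinuousM; last exact: iter_y_continuous.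
  by apply: ccontinuousM; [exact: ccontinuous_cst|exact: ccontinuousM].
- by move=> k s sb; exact: is_cderive_iter_z.
Qed.

Lemma sum_y0 i rho : (i <= 1)%N -> sum_y b F i rho 0 = (i == 0)%:R.
Proof.
move=> i1; rewrite /sum_y csum_head => [|k]; rewrite /iter_y.
  by case: i i1 => [|[|//]] _; rewrite expr0 mul1r// iterint0.
by rewrite (_ : (2 * k.+1 + i = (2 * k + i).+2)%N) ?iterint0 ?mulr0//; lia.
Qed.

Lemma sum_z0 i rho : (i <= 1)%N -> sum_z b F i rho 0 = (i == 1)%:R.
Proof.
move=> i1; rewrite /sum_z csum_head => [|k]; rewrite /iter_z.
  by case: i i1 => [|[|//]] _; rewrite expr0 mul1r.
by rewrite (_ : (2 * k.+1 + i = (2 * k + i).+2)%N) ?iterint0 ?mulr0//; lia.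
Qed.

End spps_iter.

(** * Square-integrable functions *)

Section L2.
Import HBNNSimple.
Context {R : realType}.
Local Notation mu := (@lebesgue_measure R).
Implicit Types (D : set R) (G : R -> R) (g h : R -> R[i]).

Lemma aeS (P Q : R -> Prop) : (forall t, P t -> Q t) ->
  {ae mu, forall t, P t} -> {ae mu, forall t, Q t}.
Proof.
by move=> PQ [N [mN N0 PN]]; exists N; split=> // t nQ; apply: PN => /PQ.
Qed.

Lemma aeS2 (P P' Q : R -> Prop) : (forall t, P t -> P' t -> Q t) ->
  {ae mu, forall t, P t} -> {ae mu, forall t, P' t} -> {ae mu, forall t, Q t}.
Proof.
move=> PQ [N [mN N0 PN]] [N' [mN' N'0 PN']].
exists (N `|` N'); split; first exact: measurableU.
  exact: null_set_setU.
move=> t nQ; have [Pt|/PN Nt] := pselect (P t); last by left.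
by right; apply: PN' => P't; apply: nQ; exact: PQ.
Qed.

(** The integral of a nonnegative function is the supremum over the simple
    functions below it, and these are almost everywhere below h. *)
Lemma ge0_le_integral_majorant D (g h : R -> \bar R) : measurable D ->
  (forall t, D t -> (0 <= g t)%E) -> (forall t, D t -> (0 <= h t)%E) ->
  measurable_fun D h -> {ae mu, forall t, D t -> (g t <= h t)%E} ->
  (\int[mu]_(t in D) g t <= \int[mu]_(t in D) h t)%E.
Proof.
move=> mD g0 h0 mh gh; rewrite ge0_integralE//; apply: ub_ereal_sup => _ [k /= kg <-].
rewrite -integralT_nnsfun [leRHS]integral_mkcond.
apply: ae_ge0_le_integral => //.
- by move=> t _; rewrite lee_fin.
- by apply/measurable_EFinP; exact: measurable_funP.
- by move=> t _; rewrite patchE; case: ifPn => // /set_mem; exact: h0.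
- by have := (measurable_restrictT _ mD).1 mh.
- apply: aeS gh => t gh _; apply: le_trans (kg t) _.
  by rewrite !patchE; case: ifPn => // /set_mem; exact: gh.
Qed.

Definition square_integrable D G := [/\ measurable_fun D G,
  (forall t, D t -> 0 <= G t) & (\int[mu]_(t in D) (G t ^+ 2)%:E < +oo)%E].

Definition rnorm D G : R := fine ((\int[mu]_(t in D) (G t ^+ 2)%:E) `^ 2^-1)%E.

Lemma rnorm_ge0 D G : 0 <= rnorm D G.
Proof. by rewrite fine_ge0// poweR_ge0. Qed.

Lemma measurable_sqr D G : measurable_fun D G ->
  measurable_fun D (fun t => (G t ^+ 2)%:E).
Proof. by move=> mG; apply/measurable_EFinP; exact: measurable_funX. Qed.

Lemma L2norm_le D (C : R) g G : measurable D -> 0 <= C -> square_integrable D G ->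
  {ae mu, forall t, D t -> normc (g t) <= C * G t} ->
  (L2norm D g <= (C * rnorm D G)%:E)%E.
Proof.
move=> mD C0 [mG G0 Gfin] gG.
have I0 : (0 <= \int[mu]_(t in D) (G t ^+ 2)%:E)%E.
  by apply: integral_ge0 => t _; rewrite lee_fin sqr_ge0.
have E : (C * rnorm D G)%:E =
    ((\int[mu]_(t in D) ((C * G t) ^+ 2)%:E) `^ 2^-1)%E.
  under eq_integral do rewrite exprMn EFinM.
  rewrite ge0_integralZl_EFin ?sqr_ge0//; first last.
  - exact: measurable_sqr.
  - by move=> t _; rewrite lee_fin sqr_ge0.
  rewrite poweRM ?lee_fin ?sqr_ge0// poweR_EFin powR12_sqrt ?sqr_ge0//.
  rewrite sqrtr_sqr ger0_norm// EFinM /rnorm fineK//.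
  by rewrite ge0_fin_numE ?poweR_ge0//; exact: poweR_lty.
rewrite /L2norm E; apply: gt0_ler_poweR => //.
- rewrite in_itv/= leey andbT; apply: integral_ge0 => t _.
  by rewrite lee_fin sqr_ge0.
- rewrite in_itv/= leey andbT; apply: integral_ge0 => t _.
  by rewrite lee_fin sqr_ge0.
apply: ge0_le_integral_majorant => //.
- by move=> t _; rewrite lee_fin sqr_ge0.
- by move=> t _; rewrite lee_fin sqr_ge0.
- by apply: measurable_sqr; apply: measurable_funM => //; exact: measurable_cst.
apply: aeS gG => t gG Dt; rewrite lee_fin lerXn2r ?nnegrE ?normc_ge0 ?gG//.
by rewrite mulr_ge0// G0.
Qed.

Definition cmeasurable D h := measurable_fun D (fun t => complex.Re (h t)) /\
  measurable_fun D (fun t => complex.Im (h t)).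

Lemma cmeasurableD D g h : cmeasurable D g -> cmeasurable D h ->
  cmeasurable D (fun t => g t + h t).
Proof.
move=> [gr gi] [hr hi]; split.
  by under eq_fun do rewrite cReE; exact: measurable_funD.
by under eq_fun do rewrite cImE; exact: measurable_funD.
Qed.

Lemma cmeasurableM D g h : cmeasurable D g -> cmeasurable D h ->
  cmeasurable D (fun t => g t * h t).
Proof.
move=> [gr gi] [hr hi]; split.
  by under eq_fun do rewrite cReE; apply: measurable_funB; exact: measurable_funM.
by under eq_fun do rewrite cImE; apply: measurable_funD; exact: measurable_funM.
Qed.

Lemma ccontinuous_measurable D g : ccontinuous g -> cmeasurable D g.
Proof.
move=> cg; split; apply: measurable_funTS; apply: continuous_measurable_fun.
  exact: ccontinuous_Re.
exact: ccontinuous_Im.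
Qed.

Lemma cmeasurableS D D' g : measurable D -> D' `<=` D -> cmeasurable D g ->
  cmeasurable D' g.
Proof. by move=> mD DD [gr gi]; split; apply: measurable_funS; eassumption. Qed.

Lemma measurable_normc D g : cmeasurable D g -> measurable_fun D (fun t => normc (g t)).
Proof.
move=> [gr gi]; under eq_fun do rewrite normc_sqrt.
have ms : measurable_fun setT (Num.sqrt : R -> R).
  by apply: continuous_measurable_fun; exact: sqrt_continuous.
apply: (measurableT_comp ms).
by apply: measurable_funD; exact: measurable_funX.
Qed.

(** Meant for derivatives, which agree with an explicit measurable function only
    almost everywhere. *)
Lemma L2_majorant D (C : R) g h G : measurable D -> 0 <= C ->
  square_integrable D G -> cmeasurable D h ->
  {ae mu, forall t, D t -> g t = h t} ->
  {ae mu, forall t, D t -> normc (g t) <= C * G t} -> L2 D g.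
Proof.
move=> mD C0 sG [mr mi] gh gG; exists h; split=> //.
apply: le_lt_trans (ltry (C * rnorm D G)); apply: L2norm_le => //.
by apply: aeS2 gh gG => t gh gG Dt; rewrite -gh// gG.
Qed.

Lemma square_integrable_one_add (a b : R) h : cmeasurable `]a, b[ h ->
  (L2norm `]a, b[ h < +oo)%E -> square_integrable `]a, b[ (fun t => 1 + normc (h t)).
Proof.
move=> mh hfin; have mn := measurable_normc mh; split.
- by apply: measurable_funD => //; exact: measurable_cst.
- by move=> t _; rewrite addr_ge0// normc_ge0.
have I0 : (0 <= \int[mu]_(t in `]a, b[) (normc (h t) ^+ 2)%:E)%E.
  by apply: integral_ge0 => t _; rewrite lee_fin sqr_ge0.
have {}hfin : (\int[mu]_(t in `]a, b[) (normc (h t) ^+ 2)%:E < +oo)%E.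
  by apply: lty_poweRy hfin; rewrite invr_eq0.
apply: (@le_lt_trans _ _
  (\int[mu]_(t in `]a, b[) (2%:E + 2%:E * (normc (h t) ^+ 2)%:E))%E).
  apply: ge0_le_integral => //=.
  - by move=> t _; rewrite lee_fin sqr_ge0.
  - by apply: measurable_sqr; apply: measurable_funD => //; exact: measurable_cst.
  - apply: emeasurable_funD; first exact: measurable_cst.
    by apply: measurable_funeM; exact: measurable_sqr.
  (* (1 + a)^2 <= 2 + 2 a^2 *)
  move=> t _; rewrite -EFinM -EFinD lee_fin.
  by have := sqr_ge0 (1 - normc (h t)); rewrite !expr2; lra.
rewrite ge0_integralD//=; first last.
- by apply: measurable_funeM; exact: measurable_sqr.
- by move=> t _; rewrite mule_ge0 ?lee_fin ?sqr_ge0.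
rewrite lte_add_pinfty//.
  rewrite integral_cst//= lebesgue_measure_itv/=.
  by case: ifP => _; rewrite ?mule0// -EFinB -EFinM ltry.
rewrite ge0_integralZl_EFin//; first by rewrite lte_mul_pinfty.
- by move=> t _; rewrite lee_fin sqr_ge0.
- exact: measurable_sqr.
Qed.

Lemma square_integrable_one (a b : R) : square_integrable `]a, b[ (fun=> 1).
Proof.
have m0 : cmeasurable `]a, b[ (fun=> 0 : R[i]).
  by apply: ccontinuous_measurable; exact: ccontinuous_cst.
have := square_integrable_one_add m0.
rewrite ComplexField.Normc.normc0 addr0; apply.
rewrite /L2norm; under eq_integral do rewrite ComplexField.Normc.normc0 expr0n.
by rewrite integral0 poweR0r ?invr_eq0// ltry.
Qed.

Lemma square_integrableS D D' G : measurable D -> measurable D' -> D' `<=` D ->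
  square_integrable D G -> square_integrable D' G.
Proof.
move=> mD mD' DD [mG G0 Gfin]; split.
- exact: measurable_funS mG.
- by move=> t /DD; exact: G0.
apply: le_lt_trans Gfin; apply: ge0_subset_integral => //.
  exact: measurable_sqr.
by move=> t _; rewrite lee_fin sqr_ge0.
Qed.

(** Pointwise the remainder after n terms is at most a tail of the series of c
    times 2 G; so its norm is small uniformly in rho. *)
Lemma L2_normal_series (K : set R[i]) D G (c : nat -> R)
    (t : R[i] -> nat -> R -> R[i]) (s : R[i] -> R -> R[i]) :
  measurable D -> square_integrable D G -> cvgn (series c) ->
  (forall k, 0 <= c k) ->
  (forall rho, K rho -> {ae mu, forall y, D y ->
     (forall k, normc (t rho k y) <= c k * G y) /\
     s rho y = csum (fun k => t rho k y)}) ->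
  L2_abs_unif_cvg K D t s.
Proof.
move=> mD sG cc c0 ts; split=> [rho Krho|e e0].
  apply: (@le_lt_trans _ _ (rnorm D G * limn (series c))%:E); last exact: ltry.
  apply: lime_le; first by apply: is_cvg_nneseries => n _ _; exact: poweR_ge0.
  apply: nearW => n.
  apply: (@le_trans _ _ (\sum_(0 <= k < n) (c k * rnorm D G)%:E)%E).
    apply: lee_sum => k _; apply: L2norm_le => //.
    by apply: aeS (ts _ Krho) => y ty Dy; have [] := ty Dy.
  rewrite sumEFin lee_fin -mulr_suml mulrC ler_wpM2l ?rnorm_ge0//.
  by apply: nondecreasing_cvgn_le => //; exact: nondecreasing_series.
have t0 n : 0 <= tail c n.
  by rewrite subr_ge0; apply: nondecreasing_cvgn_le => //; exact: nondecreasing_series.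
have C0 : 0 <= 2 * rnorm D G by rewrite mulr_ge0// rnorm_ge0.
have := tail_near cc C0 e0; apply: filterS => n Hn rho Krho.
apply: (@le_lt_trans _ _ (2 * tail c n * rnorm D G)%:E); last first.
  by rewrite lte_fin mulrAC.
apply: L2norm_le => //; first by rewrite mulr_ge0.
apply: aeS (ts _ Krho) => y ty Dy; have [tc ->] := ty Dy.
have G0 : 0 <= G y by have [_ + _] := sG; exact.
have cG : cvgn (series (fun k => G y * c k)) by exact: is_cvg_seriesZ.
apply: le_trans (normal_csum n cG _) _; first by move=> k; rewrite mulrC.
rewrite -mulrA ler_wpM2l// /tail lim_seriesZ//.
rewrite (_ : series _ n = G y * series c n); first by rewrite -mulrBr mulrC.
by rewrite !seriesEnat/= mulr_sumr.
Qed.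

Lemma L2_abs_unif_cvg_L2 D (t : R[i] -> nat -> R -> R[i]) (s : R[i] -> R -> R[i])
    (rho : R[i]) :
  (forall k, L2 D (t rho k)) -> L2 D (s rho) ->
  L2_abs_unif_cvg [set rho] D t s -> L2_cvg D (t rho) (s rho).
Proof.
move=> tL sL [_ ts]; split=> //.
apply/fine_cvgP; split.
  apply: filterS (ts 1 ltr01) => n /(_ rho erefl) H.
  by rewrite ge0_fin_numE ?poweR_ge0//; apply: lt_trans H _; exact: ltry.
apply/cvgrPdist_lt => e e0; apply: filterS (ts e e0) => n /(_ rho erefl) H.
rewrite sub0r normrN ger0_norm ?fine_ge0 ?poweR_ge0//.
rewrite -lte_fin fineK// ge0_fin_numE ?poweR_ge0//.
by apply: lt_trans H _; exact: ltry.
Qed.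

End L2.

(** * Solutions and their Wronskian *)

Section solutions.
Context {R : realType}.
Variables (b : R) (q : R -> R[i]) (N : nat) (x : nat -> R) (alpha : nat -> R[i]).
Hypotheses (b0 : 0 < b) (x0 : x 0%N = 0) (xb : x N.+1 = b)
  (xlt : forall k, (k <= N)%N -> x k < x k.+1).
Local Notation mu := (@lebesgue_measure R).

Lemma node_le i j : (i <= j)%N -> (j <= N.+1)%N -> x i <= x j.
Proof.
elim: j => [|j IH]; first by rewrite leqn0 => /eqP ->.
rewrite leq_eqVlt => /predU1P[-> //|ij jN].
by apply: le_trans (ltW (xlt jN)); apply: IH => //; exact: ltnW.
Qed.

Lemma node_ge0 k : (k <= N.+1)%N -> 0 <= x k.
Proof. by move=> kN; rewrite -x0 node_le. Qed.

Lemma node_leb k : (k <= N.+1)%N -> x k <= b.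
Proof. by move=> kN; rewrite -xb node_le. Qed.

Lemma piece_sub k t : (k <= N)%N -> t \in `]x k, x k.+1[ -> t \in `]0, b[.
Proof.
move=> kN; rewrite !in_itv/= => /andP[xt tx].
by rewrite (le_lt_trans (node_ge0 (leqW kN)) xt) (lt_le_trans tx)// node_leb.
Qed.

Lemma piece_subset k : (k <= N)%N -> `]x k, x k.+1[ `<=` `[0, b].
Proof. by move=> kN t /= tk; apply: subset_itv_oo_cc; exact: piece_sub kN tk. Qed.

Lemma piece_cover t : t \in `[0, b] ->
  exists2 k, (k <= N)%N & t \in `[x k, x k.+1].
Proof.
rewrite in_itv/= => /andP[t0 tb].
have : forall n, (n <= N.+1)%N -> t <= x n ->
    exists2 k, (k <= N)%N & t \in `[x k, x k.+1].
  elim=> [_ tx|n IH nN tx].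
    exists 0%N => //; rewrite in_itv/= x0 t0/= (le_trans tx)// ltW//; exact: xlt.
  have [tn|/ltW nt] := leP t (x n); first by apply: IH => //; exact: ltnW.
  by exists n => //; rewrite in_itv/= nt tx.
by apply; [exact: leqnn|rewrite xb].
Qed.

Lemma ae_piece : {ae mu, forall t, t \in `]0, b[ ->
  exists2 k, (k <= N)%N & t \in `]x k, x k.+1[}.
Proof.
exists (\bigcup_k [set x k]); split.
- by apply: bigcup_measurable => k _; exact: measurable_set1.
- by apply: countable_lebesgue_measure0; apply: bigcup_countable => // k _.
move=> t /= nt; apply: contrapT => tx; apply: nt => tb.
have [|k kN] := @piece_cover t; first exact: subset_itv_oo_cc.
rewrite in_itv/= => /andP[xt tk]; exists k => //; rewrite in_itv/= !lt_neqAle xt tk !andbT.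
by apply/andP; split; apply/negP => /eqP E; apply: tx; [exists k|exists k.+1].
Qed.

Variables (lambda : R[i]).
Local Notation solution := (is_solution b q N x alpha lambda).

Lemma D2_ccontinuous v : D2 b N x alpha v -> ccontinuous (v \o clamp b).
Proof. by case=> vac _ _; exact: abs_cont_ccontinuous. Qed.

Lemma ccvg_clamp_right (v : R -> R[i]) t : ccontinuous (v \o clamp b) ->
  0 <= t -> t < b -> ccvg t^'+ v (v t).
Proof.
move=> cv t0 tb; have := @ccvg_at_right _ _ t cv.
rewrite [X in ccvg _ _ X]/= clamp_id; last by rewrite in_itv/= t0 ltW.
apply: ccvg_near; near=> s; rewrite /= clamp_id// in_itv/=.
apply/andP; split; last by near: s; exact: nbhs_right_le.
by apply: (le_trans t0); near: s; exact: nbhs_right_ge.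
Unshelve. all: by end_near. Qed.

Lemma ccvg_clamp_left (v : R -> R[i]) t : ccontinuous (v \o clamp b) ->
  0 < t -> t <= b -> ccvg t^'- v (v t).
Proof.
move=> cv t0 tb; have := @ccvg_at_left _ _ t cv.
rewrite [X in ccvg _ _ X]/= clamp_id; last by rewrite in_itv/= (ltW t0).
apply: ccvg_near; near=> s; rewrite /= clamp_id// in_itv/=.
apply/andP; split; first by near: s; exact: nbhs_left_ge.
by apply: le_trans tb; near: s; exact: nbhs_left_le.
Unshelve. all: by end_near. Qed.

Definition wronskian (v w : R -> R[i]) (t : R) :=
  v t * cderive w t - cderive v t * w t.

(** Almost everywhere (v w' - v' w)' = v w'' - v'' w, which vanishes because v''
    and w'' are the same multiple q - lambda of v and w. *)
Lemma wronskian_piece v w k : solution v -> solution w -> (k <= N)%N ->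
  exists c, forall t, t \in `]x k, x k.+1[ -> wronskian v w t = c.
Proof.
move=> [[vac vH _] vE] [[wac wH _] wE] kN.
have [dv dvac ddv _] := vH k kN; have [dw dwac ddw _] := wH k kN.
have vac' := abs_contS (piece_subset kN) vac.
have wac' := abs_contS (piece_subset kN) wac.
have [C1 C10 vC] := abs_cont_bounded vac'; have [C2 C20 wC] := abs_cont_bounded wac'.
have [C3 C30 dvC] := abs_cont_bounded dvac; have [C4 C40 dwC] := abs_cont_bounded dwac.
have Wac : abs_cont `]x k, x k.+1[ (wronskian v w).
  apply: (@abs_cont_dom _ _ 1 (fun t => v t * cderive w t) (fun t => cderive v t * w t)).
  - exact: ler01.
  - move=> s t _ _; rewrite mul1r /wronskian -(normcN (_ - cderive v s * _)).
    rewrite (_ : _ - _ - _ = (v t * cderive w t - v s * cderive w s) +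
      - (cderive v t * w t - cderive v s * w s)); last by ring.
    exact: le_normcD.
  - apply: (@abs_contM _ _ (C1 + C4)) => //; first exact: addr_ge0.
      by move=> t tk; rewrite ler_wpDr// vC.
    by move=> t tk; rewrite ler_wpDl// dwC.
  - apply: (@abs_contM _ _ (C3 + C2)) => //; first exact: addr_ge0.
      by move=> t tk; rewrite ler_wpDr// dvC.
    by move=> t tk; rewrite ler_wpDl// wC.
have W0 : {ae mu, forall t, t \in `]x k, x k.+1[ -> is_cderive (wronskian v w) t 0}.
  have A := aeS2 (fun t p p' => conj p p') (vE k kN) (wE k kN).
  have B := aeS2 (fun t p p' => conj p p') ddv ddw.
  apply: aeS2 A B => t [vEt wEt] [ddvt ddwt] tk.
  have Dv := is_cderiveP (dv t tk); have Dw := is_cderiveP (dw t tk).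
  have Dv' := is_cderiveP (ddvt tk); have Dw' := is_cderiveP (ddwt tk).
  have := is_cderiveB (is_cderiveM Dv Dw') (is_cderiveM Dv' Dw).
  congr is_cderive.
  have {}vEt : cderive (cderive v) t = (q t - lambda) * v t.
    by rewrite mulrBl -(vEt tk); ring.
  have {}wEt : cderive (cderive w) t = (q t - lambda) * w t.
    by rewrite mulrBl -(wEt tk); ring.
  by rewrite vEt wEt; ring.
exists (wronskian v w ((x k + x k.+1) / 2)) => t tk.
apply: (abs_cont_derive0 Wac W0) => //; rewrite in_itv/=.
by have := xlt kN => ?; apply/andP; split; lra.
Qed.

(** The jumps of v' and w' at a node are the same multiple of v and w, so
    they cancel in the Wronskian. *)
Lemma wronskian_const v w : solution v -> solution w ->
  exists c, forall k t, (k <= N)%N -> t \in `]x k, x k.+1[ -> wronskian v w t = c.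
Proof.
move=> vS wS; have [c Hc] := wronskian_piece vS wS (leq0n N).
exists c => k t kN; elim: k kN t => [_|k IH kN]; first exact: Hc.
have [c' Hc'] := wronskian_piece vS wS kN.
suff -> : c = c' by [].
have kN' : (k <= N)%N by exact: ltnW.
have [[[vD vH vJ] _] [[wD wH wJ] _]] := (vS, wS).
have cv := D2_ccontinuous (proj1 vS); have cw := D2_ccontinuous (proj1 wS).
have x1 : (1 <= k.+1 <= N)%N by [].
have [vl [vr [vl_ vr_ vj]]] := vJ _ x1; have [wl [wr [wl_ wr_ wj]]] := wJ _ x1.
have xk0 : 0 < x k.+1 by apply: le_lt_trans (xlt kN'); apply: node_ge0; exact: leqW.
have xkb : x k.+1 < b by apply: lt_le_trans (xlt kN) _; exact: node_leb.
have Wl : ccvg (x k.+1)^'- (wronskian v w) (v (x k.+1) * wl - vl * w (x k.+1)).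
  by apply: ccvgB; apply: ccvgM => //; apply: ccvg_clamp_left => //; exact: ltW.
have Wr : ccvg (x k.+1)^'+ (wronskian v w) (v (x k.+1) * wr - vr * w (x k.+1)).
  by apply: ccvgB; apply: ccvgM => //; apply: ccvg_clamp_right => //; exact: ltW.
have El : c = v (x k.+1) * wl - vl * w (x k.+1).
  apply: ccvg_unique Wl; apply: (@ccvg_near _ _ _ (fun=> c)); last exact: ccvg_cst.
  near=> s; rewrite IH// in_itv/=; apply/andP; split; near: s.
    by apply: nbhs_left_gt; exact: xlt.
  exact: nbhs_left_lt.
have Er : c' = v (x k.+1) * wr - vr * w (x k.+1).
  apply: ccvg_unique Wr; apply: (@ccvg_near _ _ _ (fun=> c')); last exact: ccvg_cst.
  near=> s; rewrite Hc'// in_itv/=; apply/andP; split; near: s.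
    exact: nbhs_right_gt.
  by apply: nbhs_right_lt; exact: xlt.
rewrite El Er (_ : wr = wl + (wr - wl)); last by ring.
rewrite (_ : vr = vl + (vr - vl)); last by ring.
by rewrite wj vj; ring.
Unshelve. all: by end_near. Qed.

(** The nodes are limits of points of the open pieces. *)
Lemma zero_of_pieces (g : R -> R[i]) : ccontinuous (g \o clamp b) ->
  (forall k t, (k <= N)%N -> t \in `]x k, x k.+1[ -> g t = 0) ->
  forall t, t \in `[0, b] -> g t = 0.
Proof.
move=> cg g0 t /piece_cover[k kN]; rewrite in_itv/= => /andP[kt tk].
have [xk0 xk1] : 0 <= x k /\ x k.+1 <= b.
  by split; [apply: node_ge0; exact: leqW|exact: node_leb].
have xk := xlt kN.
have [tk'|tx] := ltP t (x k.+1); last first.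
  have -> : t = x k.+1 by apply/le_anti; rewrite tk.
  apply: (@ccvg_unique _ (x k.+1)^'- _ g); last first.
    apply: (@ccvg_near _ _ _ (fun=> 0)); last exact: ccvg_cst.
    near=> s; rewrite (g0 k)// in_itv/=; apply/andP; split; near: s.
      exact: nbhs_left_gt.
    exact: nbhs_left_lt.
  by apply: ccvg_clamp_left => //; exact: le_lt_trans xk.
have [kt'|xt] := ltP (x k) t.
  by apply: (g0 k) => //; rewrite in_itv/= kt'.
have -> : t = x k by apply/le_anti; rewrite kt xt.
apply: (@ccvg_unique _ (x k)^'+ _ g); last first.
  apply: (@ccvg_near _ _ _ (fun=> 0)); last exact: ccvg_cst.
  near=> s; rewrite (g0 k)// in_itv/=; apply/andP; split; near: s.
    exact: nbhs_right_gt.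
  exact: nbhs_right_lt.
by apply: ccvg_clamp_right => //; exact: lt_le_trans xk1.
Unshelve. all: by end_near. Qed.

(** For spanning, w (u v' - u' v) = v (u w' - u' w) - u (v w' - v' w), where the
    three Wronskians are constants and the first of them is 1. *)
Lemma wronskian_fundamental u v : solution u -> solution v ->
  (forall t, t \in `]0, x 1%N[ -> wronskian u v t = 1) ->
  u 0 != 0 -> v 0 = 0 -> fundamental_set b solution u v.
Proof.
move=> uS vS uv1 u0 v0; split=> //.
  move=> c d cd.
  have in0 : 0 \in `[0, b] by rewrite in_itv/= lexx ltW.
  have c0 : c = 0.
    by have /eqP := cd 0 in0; rewrite v0 mulr0 addr0 mulf_eq0 (negbTE u0) orbF => /eqP.
  split=> //; apply/eqP/negP => /negP d0.
  have v00 t : t \in `[0, b] -> v t = 0.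
    by move=> /cd/eqP; rewrite c0 mul0r add0r mulf_eq0 (negbTE d0)/= => /eqP.
  pose t := x 1%N / 2.
  have x1 : 0 < x 1%N by rewrite -x0; exact: xlt.
  have t1 : t \in `]x 0%N, x 1%N[ by rewrite x0 in_itv/= /t; apply/andP; split; lra.
  have dv0 : cderive v t = 0.
    apply: is_cderiveE; apply: (@is_cderive_near _ (fun=> 0)); last exact: is_cderive_cst.
    have := piece_sub (leq0n N) t1; rewrite in_itv/= => /andP[t0 tb].
    near=> s; rewrite v00// in_itv/=; apply/andP; split; apply: ltW; near: s.
      exact: lt_nbhsr.
    exact: lt_nbhsl.
  have : wronskian u v t = 1 by apply: uv1; rewrite -{1}x0.
  rewrite /wronskian dv0 v00 ?mulr0 ?subr0.
    by move/eqP; rewrite eq_sym oner_eq0.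
  by apply: (piece_subset (leq0n N)).
move=> w wS.
have [c1 uw] := wronskian_const uS wS; have [c2 vw] := wronskian_const vS wS.
have [c uv] := wronskian_const uS vS.
have c1E : c = 1.
  have x1 : 0 < x 1%N by rewrite -x0; exact: xlt.
  have t1 : x 1%N / 2 \in `]x 0%N, x 1%N[.
    by rewrite x0 in_itv/=; apply/andP; split; lra.
  by rewrite -(uv 0%N _ (leq0n N) t1) uv1//; rewrite -{1}x0.
exists (- c2), c1 => t tb.
apply/eqP; rewrite -subr_eq0; apply/eqP; move: t tb.
apply: (zero_of_pieces (g := fun t => w t - (- c2 * u t + c1 * v t))) => [|k t kN tk].
  have [[cu cv] cw] := (D2_ccontinuous uS.1, D2_ccontinuous vS.1,
    D2_ccontinuous wS.1).
  move=> t; apply: ccvgB; first exact: cw.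
  by apply: ccvgD; apply: ccvgM; [exact: ccvg_cst|exact: cu|exact: ccvg_cst|exact: cv].
have := uv k t kN tk; have := uw k t kN tk; have := vw k t kN tk.
rewrite c1E /wronskian => <- <- h.
by rewrite -[w t in X in X - _]mulr1 -h; ring.
Unshelve. all: by end_near. Qed.

End solutions.

(** * Functions factored by a solution *)

Section solution_factorisation.
Context {R : realType}.
Local Notation mu := (@lebesgue_measure R).

Variables (b : R) (q : R -> R[i]) (N : nat) (x : nat -> R) (alpha : nat -> R[i]).
Hypotheses (b0 : 0 < b) (qL2 : L2 `]0, b[ q) (x0 : x 0%N = 0) (xb : x N.+1 = b)
  (xlt : forall k, (k <= N)%N -> x k < x k.+1).
Variable f : R -> R[i].
Hypotheses (fS : is_solution b q N x alpha 0 f)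
  (f0 : forall t, t \in `[0, b] -> f t != 0).

Let F := f \o clamp b.

Let FE t : t \in `[0, b] -> F t = f t.
Proof. by move=> tb; rewrite /F/= clamp_id. Qed.

Let cF : ccontinuous F.
Proof. exact: (D2_ccontinuous b0 fS.1). Qed.

Let F0 t : F t != 0.
Proof. by apply: f0; exact: clamp_in. Qed.

Let cFV : ccontinuous (fun t => (F t)^-1).
Proof. exact: ccontinuousV. Qed.

Lemma cderive_bounded : exists2 C : R, 0 <= C &
  forall k t, (k <= N)%N -> t \in `]x k, x k.+1[ -> normc (cderive f t) <= C.
Proof.
have [[_ fH _] _] := fS.
suff : forall n, (n <= N.+1)%N -> exists2 C : R, 0 <= C &
    forall k t, (k < n)%N -> t \in `]x k, x k.+1[ -> normc (cderive f t) <= C.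
  by move=> /(_ N.+1 (leqnn _)).
elim=> [_|n IH nN]; first by exists 0.
have [C C0 HC] := IH (ltnW nN); have [_ fac _ _] := fH n nN.
have [C' C'0 HC'] := abs_cont_bounded fac.
exists (C + C'); first exact: addr_ge0.
move=> k t; rewrite ltnS leq_eqVlt => /predU1P[->|kn] tk.
  by rewrite ler_wpDl// HC'.
by rewrite ler_wpDr// (HC k).
Qed.

Let pieces := \bigcup_k (if (k <= N)%N then `]x k, x k.+1[%classic else set0).

Let measurable_pieces k :
  measurable (if (k <= N)%N then `]x k, x k.+1[%classic else set0).
Proof. by case: ifP => // _; exact: measurable_itv. Qed.

(** On the open pieces f' is continuous, so its extension by zero to the
    remaining points is measurable. *)
Lemma cderive_measurable : exists h : R -> R[i],
  cmeasurable `]0, b[ h /\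
  forall k t, (k <= N)%N -> t \in `]x k, x k.+1[ -> cderive f t = h t.
Proof.
have [[_ fH _] _] := fS.
pose df := cderive f.
exists (fun t => ((fun t => complex.Re (df t)) \_ pieces) t +i*
                 ((fun t => complex.Im (df t)) \_ pieces) t).
have mp : measurable pieces by apply: bigcup_measurable => k _.
have main (g : R -> R) : (forall k t, (k <= N)%N -> t \in `]x k, x k.+1[ ->
    {for t, continuous g}) -> measurable_fun `]0, b[ (g \_ pieces).
  move=> cg; apply: measurable_funTS; apply/(measurable_restrictT _ mp).
  apply/measurable_fun_bigcup => // k; case: ifPn => [kN|_]; last exact: measurable_fun_set0.
  apply: open_continuous_measurable_fun; first exact: interval_open.
  by move=> t /set_mem; exact: cg.
split; first split.
- apply: main => k t kN tk; have [_ fac _ _] := fH k kN.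
  exact: (proj1 (abs_cont_continuous_oo fac tk)).
- apply: main => k t kN tk; have [_ fac _ _] := fH k kN.
  exact: (proj2 (abs_cont_continuous_oo fac tk)).
move=> k t kN tk; have tP : t \in pieces by apply/mem_set; exists k; rewrite ?kN.
by apply: complex_eq; rewrite /= patchE tP.
Qed.

(* The function u is handled through y and z, which are smoother than u. *)
Section factor.
Variables (u y z dz : R -> R[i]).
Hypotheses (uE : forall t, t \in `[0, b] -> u t = F t * y t)
  (cy : ccontinuous y) (cz : ccontinuous z)
  (dy : forall t, t \in `]0, b[ -> is_cderive y t ((F t)^-1 * (F t)^-1 * z t))
  (zdz : forall t, t \in `]0, b[ -> is_cderive z t (dz t)).

Lemma factor_cderive k t : (k <= N)%N -> t \in `]x k, x k.+1[ ->
  is_cderive u t (cderive f t * y t + (F t)^-1 * z t).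
Proof.
move=> kN tk; have tb := piece_sub x0 xb xlt kN tk.
have [[_ fH _] _] := fS; have [df _ _ _] := fH k kN.
have := is_cderiveM (is_cderiveP (df t tk)) (dy tb).
rewrite -(FE (subset_itv_oo_cc tb)) mulrA (mulrA (F t)) divff// mul1r.
apply: is_cderive_near; move: tb; rewrite in_itv/= => /andP[t0 tb].
near=> s; rewrite uE ?FE// in_itv/=; apply/andP; split; apply: ltW; near: s;
  by [exact: lt_nbhsr|exact: lt_nbhsl].
Unshelve. all: by end_near. Qed.

(** The derivative of F^-1 z contributes - f' F^-2 z, which cancels f' y'. *)
Lemma factor_cderive2 k t : (k <= N)%N -> t \in `]x k, x k.+1[ ->
  cderivable (cderive f) t ->
  is_cderive (cderive u) t (cderive (cderive f) t * y t + (F t)^-1 * dz t).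
Proof.
move=> kN tk ddf; have tb := piece_sub x0 xb xlt kN tk.
have [[_ fH _] _] := fS; have [df _ _ _] := fH k kN.
have dF : is_cderive F t (cderive f t).
  apply: is_cderive_near (is_cderiveP (df t tk)).
  move: tb; rewrite in_itv/= => /andP[t0 tb].
  near=> s; rewrite FE// in_itv/=; apply/andP; split; apply: ltW; near: s;
    by [exact: lt_nbhsr|exact: lt_nbhsl].
have D := is_cderiveD (is_cderiveM (is_cderiveP ddf) (dy tb))
  (is_cderiveM (is_cderiveV (F0 t) dF) (zdz tb)).
apply: (@is_cderive_near _ (fun t => cderive f t * y t + (F t)^-1 * z t)).
  move: tk; rewrite in_itv/= => /andP[t0 t1].
  near=> s; apply/esym/is_cderiveE/(@factor_cderive k) => //.
  by rewrite in_itv/=; apply/andP; split; near: s;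
    [exact: lt_nbhsr|exact: lt_nbhsl].
move: D; congr is_cderive; field; exact: F0.
Unshelve. all: by end_near. Qed.

Lemma factor_ccontinuous : ccontinuous (u \o clamp b).
Proof.
have cl : forall g, ccontinuous g -> ccontinuous (g \o clamp b).
  move=> g cg t; have [gr gi] := cg (clamp b t).
  split.
    exact: (@cvg_comp _ _ _ (clamp b) (fun s => complex.Re (g s)) _ _ _
      (@clamp_continuous _ b t) gr).
  exact: (@cvg_comp _ _ _ (clamp b) (fun s => complex.Im (g s)) _ _ _
    (@clamp_continuous _ b t) gi).
rewrite (_ : u \o clamp b = fun t => (F \o clamp b) t * (y \o clamp b) t).
  by apply: ccontinuousM; exact: cl.
by apply/funext => t /=; rewrite uE//; exact: clamp_in.
Qed.

Lemma L2_factor : L2 `]0, b[ (cderive u).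
Proof.
have [h [mh hE]] := cderive_measurable.
have [C C0 HC] := cderive_bounded.
have [Cy Cy0 Hy] := itv_bounded b0 cy.
have [Cz Cz0 Hz] := itv_bounded b0 (ccontinuousM cFV cz).
apply: (L2_majorant (C := C * Cy + Cz) (h := fun t => h t * y t + (F t)^-1 * z t)
  _ _ (square_integrable_one 0 b)).
- exact: measurable_itv.
- by rewrite addr_ge0// mulr_ge0.
- apply: cmeasurableD; last by apply: ccontinuous_measurable; exact: ccontinuousM.
  by apply: cmeasurableM => //; exact: ccontinuous_measurable.
- apply: aeS (ae_piece x0 xb xlt) => t tE tb; have [k kN tk] := tE tb.
  by rewrite (is_cderiveE (factor_cderive kN tk)) (hE k).
apply: aeS (ae_piece x0 xb xlt) => t tE tb; have [k kN tk] := tE tb.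
rewrite (is_cderiveE (factor_cderive kN tk)) mulr1.
have tb' := subset_itv_oo_cc tb.
apply: le_trans (le_normcD _ _) _; apply: lerD; last exact: Hz.
by rewrite normcM ler_pM ?normc_ge0 ?(HC k) ?Hy.
Qed.

(** Almost everywhere u'' = q F y + F^-1 z', which is bounded by a multiple of
    1 + |q|. *)
Lemma L2_factor2 k : (k <= N)%N -> ccontinuous dz ->
  L2 `]x k, x k.+1[ (cderive (cderive u)).
Proof.
move=> kN cdz.
have [[_ fH _] fE] := fS; have [_ _ ddf _] := fH k kN.
have [h [qh mhr mhi hfin]] := qL2.
have mI : measurable (`]x k, x k.+1[%classic : set R) by exact: measurable_itv.
have sub : `]x k, x k.+1[ `<=` (`]0, b[%classic : set R).
  by move=> t; exact: (piece_sub x0 xb xlt kN).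
have sG := square_integrableS (measurable_itv `]0, b[) mI sub
  (square_integrable_one_add (conj mhr mhi) hfin).
have mh : cmeasurable `]x k, x k.+1[ h.
  by apply: (cmeasurableS _ sub); [exact: measurable_itv|split].
have [Cy Cy0 Hy] := itv_bounded b0 (ccontinuousM cF cy).
have [Cz Cz0 Hz] := itv_bounded b0 (ccontinuousM cFV cdz).
have E : {ae mu, forall t, t \in `]x k, x k.+1[ ->
    cderive (cderive u) t = h t * (F t * y t) + (F t)^-1 * dz t}.
  have A := aeS2 (fun t p p' => conj p p') (fE k kN) ddf.
  apply: aeS2 A qh => t [fEt ddft] qht tk.
  rewrite (is_cderiveE (factor_cderive2 kN tk (ddft tk))) -qht; last exact: sub.
  have := fEt tk; rewrite mul0r addrC => /eqP; rewrite subr_eq0 => /eqP <-.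
  by rewrite mulrA FE// (piece_subset x0 xb xlt kN).
apply: (L2_majorant (C := Cy + Cz) (h := fun t => h t * (F t * y t) + (F t)^-1 * dz t)
  mI _ sG) => //.
- exact: addr_ge0.
- apply: cmeasurableD; last by apply: ccontinuous_measurable; exact: ccontinuousM.
  by apply: cmeasurableM => //; apply: ccontinuous_measurable; exact: ccontinuousM.
apply: aeS E => t Et tk; rewrite Et//.
have tb : t \in `[0, b] := piece_subset x0 xb xlt kN tk.
apply: le_trans (le_normcD _ _) _.
have h0 := normc_ge0 (h t).
have : normc (h t * (F t * y t)) <= normc (h t) * Cy.
  by rewrite normcM ler_wpM2l// Hy.
have := Hz t tb; nra.
Qed.

Lemma factor_rderive (d : R[i]) : ccvg 0^'+ (cderive f) d ->
  is_rderive u 0 (d * y 0 + (F 0)^-1 * z 0).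
Proof.
move=> fd; have x1 : 0 < x 1%N by rewrite -x0; exact: xlt.
have x1b : x 1%N <= b := node_leb xb xlt (ltn0Sn N).
have U : is_rderive (u \o clamp b) 0 (d * y 0 + (F 0)^-1 * z 0).
  apply: (is_rderive_lim (du := fun t => cderive f t * y t + (F t)^-1 * z t) x1).
  - exact: factor_ccontinuous.
  - move=> t t1; have tk : t \in `]x 0%N, x 1%N[ by rewrite x0.
    apply: is_cderive_near (factor_cderive (leq0n N) tk).
    have := piece_sub x0 xb xlt (leq0n N) tk; rewrite in_itv/= => /andP[t0 tb].
    near=> s; rewrite /= clamp_id// in_itv/=; apply/andP; split; apply: ltW; near: s;
      by [exact: lt_nbhsr|exact: lt_nbhsl].
  by apply: ccvgD; apply: ccvgM => //; exact: ccvg_at_right.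
apply: ccvg_near U; near=> h; rewrite /rquotient /= !clamp_id//.
  by rewrite in_itv/= lexx ltW.
rewrite in_itv/= add0r; apply/andP; split; near: h.
  exact: nbhs_right_ge.
exact: nbhs_right_le.
Unshelve. all: by end_near. Qed.

(** As y and z are continuous, u' = f' y + F^-1 z jumps at a node by the jump of
    f' times y, that is alpha f y = alpha u. *)
Lemma factor_solution (lambda : R[i]) :
  (forall t, dz t = - lambda * (F t * F t) * y t) ->
  is_solution b q N x alpha lambda u.
Proof.
move=> dzE.
have [[fac fH fJ] fE] := fS.
have cdz : ccontinuous dz.
  rewrite (_ : dz = fun t => - lambda * (F t * F t) * y t); last exact/funext.
  apply: ccontinuousM => //; apply: ccontinuousM; last exact: ccontinuousM.
  exact: ccontinuous_cst.
have FacV : abs_cont `[0, b] (fun t => (F t)^-1).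
  have [C C0 HC] := itv_bounded b0 cFV.
  apply: (abs_contV C0) => //; apply: abs_cont_eq fac => t tb.
  by rewrite FE.
have lip w dw : ccontinuous w -> ccontinuous dw ->
    (forall t, t \in `]0, b[ -> is_cderive w t (dw t)) -> abs_cont `[0, b] w.
  move=> cw cdw wdw; have [C C0 HC] := itv_bounded b0 cdw.
  apply: (@lipschitz_abs_cont _ _ (2 * C)); first by rewrite mulr_ge0.
  move=> s t st; rewrite /= !in_itv/= => /andP[s0 sb] /andP[t0 tb]; rewrite -mulrA.
  have sub r : r \in `]s, t[ -> r \in `]0, b[.
    by rewrite !in_itv/= => /andP[sr rt]; rewrite (le_lt_trans s0)//= (lt_le_trans rt).
  apply: (cmvt_lipschitz st cw (du := dw)) => r /sub rb; first exact: wdw.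
  exact/HC/subset_itv_oo_cc.
have yac : abs_cont `[0, b] y.
  apply: (lip _ (fun t => (F t)^-1 * (F t)^-1 * z t)) => //.
  by apply: ccontinuousM => //; exact: ccontinuousM.
have zac : abs_cont `[0, b] z by exact: lip zdz.
have [Cf Cf0 Hf] := itv_bounded b0 cF; have [CV CV0 HV] := itv_bounded b0 cFV.
have [Cy Cy0 Hy] := itv_bounded b0 cy; have [Cz Cz0 Hz] := itv_bounded b0 cz.
split; last first.
  move=> k kN; have [_ _ ddf _] := fH k kN.
  apply: aeS2 (fE k kN) ddf => t fEt ddft tk.
  have tb : t \in `[0, b] := piece_subset x0 xb xlt kN tk.
  rewrite (is_cderiveE (factor_cderive2 kN tk (ddft tk))) uE// dzE.
  have := fEt tk; rewrite mul0r addrC => /eqP; rewrite subr_eq0 => /eqP <-.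
  by rewrite -(FE tb); field.
split.
- apply: (@abs_cont_eq _ _ (fun t => F t * y t)) => [t tb|]; first by rewrite uE.
  apply: (abs_contM (C := Cf + Cy)) => //; first exact: addr_ge0.
  + by move=> t tb; rewrite ler_wpDr// Hf.
  + by move=> t tb; rewrite ler_wpDl// Hy.
  by apply: abs_cont_eq fac => t tb; rewrite FE.
- move=> k kN; have [df dfac ddf _] := fH k kN.
  have sub := piece_subset x0 xb xlt kN.
  split.
  + by move=> t tk; apply: is_cderive_derivable; exact: factor_cderive kN tk.
  + apply: (@abs_cont_eq _ _ (fun t => cderive f t * y t + (F t)^-1 * z t)).
      by move=> t tk; rewrite (is_cderiveE (factor_cderive kN tk)).
    have [C C0 HC] := cderive_bounded.
    apply: abs_contD.
      apply: (abs_contM (C := C + Cy)) => //; first exact: addr_ge0.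
      * by move=> t tk; rewrite ler_wpDr// (HC k).
      * by move=> t tk; rewrite ler_wpDl// Hy//; exact: sub.
      exact: abs_contS yac.
    apply: (abs_contM (C := CV + Cz)) => //; first exact: addr_ge0.
    * by move=> t tk; rewrite ler_wpDr// HV//; exact: sub.
    * by move=> t tk; rewrite ler_wpDl// Hz//; exact: sub.
    * exact: abs_contS FacV.
    exact: abs_contS zac.
  + apply: aeS ddf => t ddft tk; apply: is_cderive_derivable.
    exact: factor_cderive2 kN tk (ddft tk).
  exact: L2_factor2.
move=> [//|k] kN; have [dl [dr [fl fr E]]] := fJ _ kN.
have kN' : (k.+1 <= N)%N by [].
have kN'' : (k <= N)%N by exact: ltnW.
exists (dl * y (x k.+1) + (F (x k.+1))^-1 * z (x k.+1)),
       (dr * y (x k.+1) + (F (x k.+1))^-1 * z (x k.+1)); split.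
- apply: (@ccvg_near _ _ _ (fun t => cderive f t * y t + (F t)^-1 * z t)).
    near=> s; apply/esym/is_cderiveE/(@factor_cderive k) => //.
    rewrite in_itv/=; apply/andP; split; near: s; last exact: nbhs_left_lt.
    by apply: nbhs_left_gt; exact: xlt.
  by apply: ccvgD; apply: ccvgM => //; exact: ccvg_at_left.
- apply: (@ccvg_near _ _ _ (fun t => cderive f t * y t + (F t)^-1 * z t)).
    near=> s; apply/esym/is_cderiveE/(@factor_cderive k.+1) => //.
    rewrite in_itv/=; apply/andP; split; near: s; first exact: nbhs_right_gt.
    by apply: nbhs_right_lt; exact: xlt.
  by apply: ccvgD; apply: ccvgM => //; exact: ccvg_at_right.
have xkb : x k.+1 \in `[0, b].
  rewrite in_itv/= (node_ge0 x0 xlt (leqW kN'))//=.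
  by apply: (node_leb xb xlt); exact: leqW.
rewrite uE// FE// mulrA -E; ring.
Unshelve. all: by end_near. Qed.

End factor.
End solution_factorisation.

(** * The spectral parameter power series *)

Section spps.
Context {R : realType}.
Local Notation mu := (@lebesgue_measure R).
Variables (b : R) (q : R -> R[i]) (N : nat) (x : nat -> R) (alpha : nat -> R[i]).
Hypotheses (b0 : 0 < b) (qL2 : L2 `]0, b[ q) (x0 : x 0%N = 0) (xb : x N.+1 = b)
  (xlt : forall k, (k <= N)%N -> x k < x k.+1).
Variable f : R -> R[i].
Hypotheses (fS : is_solution b q N x alpha 0 f)
  (f0 : forall t, t \in `[0, b] -> f t != 0).

Let F := f \o clamp b.

Let cF : ccontinuous F.
Proof. exact: (D2_ccontinuous b0 fS.1). Qed.

Let F0 t : F t != 0.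
Proof. by apply: f0; exact: clamp_in. Qed.

Let dz i rho k t : R[i] :=
  if k is k'.+1 then - rho ^+ 2 * (F t * F t) * iter_y b F i rho k' t else 0.

Let dz_continuous i rho k : ccontinuous (dz i rho k).
Proof.
case: k => [|k]; first exact: ccontinuous_cst.
apply: ccontinuousM; last exact: iter_y_continuous.
by apply: ccontinuousM; [exact: ccontinuous_cst|exact: ccontinuousM].
Qed.

Let sum_dz i rho t := - rho ^+ 2 * (F t * F t) * sum_y b F i rho t.

Lemma spps_solution i rho : (i <= 1)%N ->
  is_solution b q N x alpha (rho ^+ 2) (spps f i rho).
Proof.
move=> i1.
apply: (factor_solution b0 qL2 x0 xb xlt fS f0 (y := sum_y b F i rho)
  (z := sum_z b F i rho) (dz := sum_dz i rho)) => //.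
- by move=> t tb; exact: spps_sum_y.
- exact: sum_y_continuous.
- exact: sum_z_continuous.
- by move=> t tb; exact: is_cderive_sum_y.
- by move=> t tb; exact: is_cderive_sum_z.
Qed.

Lemma spps_term_cderive i rho n k t : (i <= 1)%N -> (k <= N)%N ->
  t \in `]x k, x k.+1[ -> cderive (spps_term f i rho n) t =
  cderive f t * iter_y b F i rho n t + (F t)^-1 * iter_z b F i rho n t.
Proof.
move=> i1 kN tk; apply/is_cderiveE.
apply: (factor_cderive b0 x0 xb xlt fS f0 _ _ kN tk) => // s sb; last exact: is_cderive_iter_y.
exact: spps_term_iter.
Qed.

Lemma spps_cderive i rho k t : (i <= 1)%N -> (k <= N)%N ->
  t \in `]x k, x k.+1[ -> cderive (spps f i rho) t =
  cderive f t * sum_y b F i rho t + (F t)^-1 * sum_z b F i rho t.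
Proof.
move=> i1 kN tk; apply/is_cderiveE.
apply: (factor_cderive b0 x0 xb xlt fS f0 _ _ kN tk) => // s sb; last exact: is_cderive_sum_y.
exact: spps_sum_y.
Qed.

Lemma spps_term_cderive2 i rho n k t : (i <= 1)%N -> (k <= N)%N ->
  t \in `]x k, x k.+1[ -> cderivable (cderive f) t ->
  cderive (cderive (spps_term f i rho n)) t =
  cderive (cderive f) t * iter_y b F i rho n t + (F t)^-1 * dz i rho n t.
Proof.
move=> i1 kN tk ddf; apply/is_cderiveE.
apply: (factor_cderive2 b0 x0 xb xlt fS f0 _ _ _ kN tk ddf) => // s sb.
- exact: spps_term_iter.
- exact: is_cderive_iter_y.
- exact: is_cderive_iter_z.
Qed.

Lemma spps_cderive2 i rho k t : (i <= 1)%N -> (k <= N)%N ->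
  t \in `]x k, x k.+1[ -> cderivable (cderive f) t ->
  cderive (cderive (spps f i rho)) t =
  cderive (cderive f) t * sum_y b F i rho t + (F t)^-1 * sum_dz i rho t.
Proof.
move=> i1 kN tk ddf; apply/is_cderiveE.
apply: (factor_cderive2 b0 x0 xb xlt fS f0 _ _ _ kN tk ddf) => // s sb.
- exact: spps_sum_y.
- exact: is_cderive_sum_y.
- exact: is_cderive_sum_z.
Qed.

Section uniform_in_rho.
Variables (K : set R[i]) (P : R) (i : nat).
Hypotheses (i1 : (i <= 1)%N) (KP : forall rho, K rho -> normc rho <= P).

Lemma spps_abs_unif_cvg : abs_unif_cvg (K `*` `[0, b])
  (fun k y => spps_term f i y.1 k y.2) (fun y => spps f i y.1 y.2).
Proof.
have [c [cc c0] Hc] := iter_majorant b0 cF F0 P i1.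
have [CF CF0 HF] := itv_bounded b0 cF.
apply: (normal_abs_unif_cvg (c := fun k => CF * c k)).
- exact: is_cvg_seriesZ.
- move=> [rho t] k [/= /KP rP tb]; rewrite (spps_term_iter b0 cF F0)// normcM.
  by apply: ler_pM; rewrite ?normc_ge0 ?HF//; have [] := Hc rho k t rP.
move=> [rho t] [/= /KP rP tb]; rewrite (spps_sum_y b0 cF F0)//.
rewrite -(csumZ _ cc); last by move=> k; have [] := Hc rho k t rP.
by congr csum; apply/funext => k; rewrite (spps_term_iter b0 cF F0).
Qed.

Lemma spps_cderive_unif_cvg : L2_abs_unif_cvg K `]0, b[
  (fun rho k => cderive (spps_term f i rho k))
  (fun rho => cderive (spps f i rho)).
Proof.
have [c [cc c0] Hc] := iter_majorant b0 cF F0 P i1.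
have [CV CV0 HV] := itv_bounded b0 (ccontinuousV F0 cF).
have [C C0 HC] := cderive_bounded fS.
have cc1 : cvgn (series (fun k => (C + CV) * c k)) by exact: is_cvg_seriesZ.
apply: (L2_normal_series _ (square_integrable_one 0 b) cc1).
- exact: measurable_itv.
- by move=> k; rewrite mulr_ge0// addr_ge0.
move=> rho /KP rP; apply: aeS (ae_piece x0 xb xlt) => t tE tb.
have [j jN tj] := tE tb; have Vt := HV t (subset_itv_oo_cc tb).
have df := HC j t jN tj.
have y_le k : normc (cderive f t * iter_y b F i rho k t) <= C * c k.
  by rewrite normcM; apply: ler_pM; rewrite ?normc_ge0//; have [] := Hc rho k t rP.
have z_le k : normc ((F t)^-1 * iter_z b F i rho k t) <= CV * c k.
  by rewrite normcM; apply: ler_pM; rewrite ?normc_ge0//; have [] := Hc rho k t rP.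
split.
  move=> k; rewrite (spps_term_cderive _ _ i1 jN tj) mulr1 mulrDl.
  exact: le_trans (le_normcD _ _) (lerD (y_le k) (z_le k)).
rewrite (spps_cderive _ i1 jN tj) /sum_y /sum_z.
rewrite -(csumZ _ cc); last by move=> k; have [] := Hc rho k t rP.
rewrite -(csumZ _ cc); last by move=> k; have [] := Hc rho k t rP.
rewrite -(csumD cc1).
- by congr csum; apply/funext => k; rewrite (spps_term_cderive _ _ i1 jN tj).
- by move=> k; apply: le_trans (y_le k) _; rewrite ler_wpM2r// lerDl.
by move=> k; apply: le_trans (z_le k) _; rewrite ler_wpM2r// lerDr.
Qed.

(** Almost everywhere the second derivative of a term is q F y_k + F^-1 z_k',
    which is at most a summable constant times 1 + |q|. *)
Lemma spps_cderive2_unif_cvg j : (j <= N)%N -> L2_abs_unif_cvg K `]x j, x j.+1[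
  (fun rho k => cderive (cderive (spps_term f i rho k)))
  (fun rho => cderive (cderive (spps f i rho))).
Proof.
move=> jN.
have [c [cc c0] Hc] := iter_majorant b0 cF F0 P i1.
have [CF CF0 HF] := itv_bounded b0 cF.
have [CV CV0 HV] := itv_bounded b0 (ccontinuousV F0 cF).
have [h [qh mhr mhi hfin]] := qL2.
have mI : measurable (`]x j, x j.+1[%classic : set R) by exact: measurable_itv.
have sub : `]x j, x j.+1[ `<=` (`]0, b[%classic : set R).
  by move=> t; exact: (piece_sub x0 xb xlt jN).
have sG := square_integrableS (measurable_itv `]0, b[) mI sub
  (square_integrable_one_add (conj mhr mhi) hfin).
(* The derivative of z_k involves y_(k-1), whence the shifted majorant. *)
pose c1 k := if k is k'.+1 then c k' else 0.
have c10 k : 0 <= c1 k by case: k.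
have cc1 : cvgn (series c1) by exact: is_cvg_series_shift.
pose D := P ^+ 2 * (CF * CF).
have D0 : 0 <= D by exact: mulr_ge0 (sqr_ge0 P) (mulr_ge0 CF0 CF0).
pose c2 k := CF * c k + CV * (D * c1 k).
have c20 k : 0 <= c2 k.
  by apply: addr_ge0; apply: mulr_ge0 => //; exact: mulr_ge0.
have ccD : cvgn (series (fun k => D * c1 k)) by exact: is_cvg_seriesZ.
have cc2 : cvgn (series c2).
  by apply: is_cvg_seriesD; exact: is_cvg_seriesZ.
apply: (L2_normal_series mI sG cc2 c20).
have [[_ fH _] fE] := fS; have [_ _ ddf _] := fH j jN.
have ae := aeS2 (fun t p p' => conj p p') (fE j jN) ddf.
move=> rho /KP rP; apply: aeS2 ae qh => t [fEt ddft] qht tj.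
have tb : t \in `[0, b] := piece_subset x0 xb xlt jN tj.
have d2f : cderive (cderive f) t = h t * F t.
  rewrite -qht; last exact: sub.
  have := fEt tj; rewrite mul0r addrC => /eqP; rewrite subr_eq0 => /eqP <-.
  by rewrite /F/= clamp_id.
have Ft := HF t tb; have Vt := HV t tb.
pose g := 1 + normc (h t).
have g1 : 1 <= g by rewrite lerDl normc_ge0.
have g0 : 0 <= g by apply: le_trans g1.
have dz_le k : normc (dz i rho k t) <= D * c1 k.
  case: k => [|k]; first by rewrite /dz ComplexField.Normc.normc0 mulr0.
  rewrite /dz normcM; apply: ler_pM; rewrite ?normc_ge0//; last first.
    by have [] := Hc rho k t rP.
  rewrite normcM normcN normcX; apply: ler_pM;
    rewrite ?normc_ge0 ?exprn_ge0 ?normc_ge0//.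
    by rewrite lerXn2r ?nnegrE ?normc_ge0 ?(le_trans (normc_ge0 rho)).
  by rewrite normcM; apply: ler_pM; rewrite ?normc_ge0.
have y_le k : normc (cderive (cderive f) t * iter_y b F i rho k t) <= g * (CF * c k).
  rewrite d2f -mulrA normcM; apply: ler_pM; rewrite ?normc_ge0//.
    by rewrite /g lerDr.
  by rewrite normcM; apply: ler_pM; rewrite ?normc_ge0//; have [] := Hc rho k t rP.
have z_le k : normc ((F t)^-1 * dz i rho k t) <= g * (CV * (D * c1 k)).
  rewrite normcM -[leLHS]mul1r; apply: ler_pM => //.
    by rewrite mulr_ge0 ?normc_ge0.
  by apply: ler_pM; rewrite ?normc_ge0.
split.
  move=> k; rewrite (spps_term_cderive2 _ _ i1 jN tj (ddft tj)).
  apply: le_trans (le_normcD _ _) _; apply: le_trans (lerD (y_le k) (z_le k)) _.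
  by rewrite -mulrDr mulrC.
rewrite (spps_cderive2 _ i1 jN tj (ddft tj)) /sum_dz /sum_y.
rewrite -(csum_shift (- rho ^+ 2 * (F t * F t)) cc); last by move=> k; have [] := Hc rho k t rP.
rewrite -(csumZ _ cc); last by move=> k; have [] := Hc rho k t rP.
rewrite -(csumZ _ ccD dz_le).
rewrite -(csumD (c := fun k => g * c2 k)).
- by congr csum; apply/funext => k; rewrite (spps_term_cderive2 _ _ i1 jN tj (ddft tj)).
- exact: is_cvg_seriesZ.
- move=> k; apply: le_trans (y_le k) _; rewrite ler_wpM2l// /c2 lerDl.
  by apply: mulr_ge0 => //; exact: mulr_ge0.
move=> k; apply: le_trans (z_le k) _; rewrite ler_wpM2l// /c2 lerDr.
exact: mulr_ge0.
Qed.

End uniform_in_rho.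

Lemma spps_term_L2 i rho k : (i <= 1)%N -> L2 `]0, b[ (cderive (spps_term f i rho k)).
Proof.
move=> i1; apply: (L2_factor b0 x0 xb xlt fS f0 (y := iter_y b F i rho k)
  (z := iter_z b F i rho k)).
- by move=> t tb; exact: spps_term_iter.
- exact: iter_y_continuous.
- exact: iter_z_continuous.
- by move=> t tb; exact: is_cderive_iter_y.
Qed.

Lemma spps_L2 i rho : (i <= 1)%N -> L2 `]0, b[ (cderive (spps f i rho)).
Proof.
move=> i1; apply: (L2_factor b0 x0 xb xlt fS f0 (y := sum_y b F i rho)
  (z := sum_z b F i rho)).
- by move=> t tb; exact: spps_sum_y.
- exact: sum_y_continuous.
- exact: sum_z_continuous.
- by move=> t tb; exact: is_cderive_sum_y.
Qed.

Lemma spps_term_L2_piece i rho k j : (i <= 1)%N -> (j <= N)%N ->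
  L2 `]x j, x j.+1[ (cderive (cderive (spps_term f i rho k))).
Proof.
move=> i1 jN; apply: (L2_factor2 b0 qL2 x0 xb xlt fS f0 (y := iter_y b F i rho k)
  (z := iter_z b F i rho k) (dz := dz i rho k)) => //.
- by move=> t tb; exact: spps_term_iter.
- exact: iter_y_continuous.
- by move=> t tb; exact: is_cderive_iter_y.
- by move=> t tb; exact: is_cderive_iter_z.
Qed.

Lemma spps_rderive i rho d : (i <= 1)%N -> ccvg 0^'+ (cderive f) d ->
  is_rderive (spps f i rho) 0 (d * (i == 0)%:R + (F 0)^-1 * (i == 1)%:R).
Proof.
move=> i1 fd; rewrite -(sum_y0 f b0 rho i1) -(sum_z0 f b0 rho i1).
apply: (factor_rderive b0 x0 xb xlt fS f0) => //.
- by move=> t tb; exact: spps_sum_y.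
- exact: sum_y_continuous.
- exact: sum_z_continuous.
- by move=> t tb; exact: is_cderive_sum_y.
Qed.

(** In terms of the sums y_i and z_i the Wronskian of u_0 and u_1 is
    y_0 z_1 - z_0 y_1, which tends to 1 at 0. *)
Lemma spps_wronskian rho t : t \in `]0, x 1%N[ ->
  wronskian (spps f 0 rho) (spps f 1 rho) t = 1.
Proof.
move=> t1.
have [c Hc] := wronskian_const b0 x0 xb xlt (spps_solution rho (leqnSn 0))
  (spps_solution rho (leqnn 1)).
rewrite (Hc 0%N) ?x0//.
have W : ccvg 0^'+ (fun s => sum_y b F 0 rho s * sum_z b F 1 rho s -
    sum_z b F 0 rho s * sum_y b F 1 rho s) (1 * 1 - 0 * 0).
  have y0 : sum_y b F 0 rho 0 = 1 := sum_y0 f b0 rho (leqnSn 0).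
  have z0 : sum_z b F 0 rho 0 = 0 := sum_z0 f b0 rho (leqnSn 0).
  have y1 : sum_y b F 1 rho 0 = 0 := sum_y0 f b0 rho (leqnn 1).
  have z1 : sum_z b F 1 rho 0 = 1 := sum_z0 f b0 rho (leqnn 1).
  have cy i : (i <= 1)%N -> ccvg 0^'+ (sum_y b F i rho) (sum_y b F i rho 0).
    by move=> i1; apply: ccvg_at_right; exact: sum_y_continuous.
  have cz i : (i <= 1)%N -> ccvg 0^'+ (sum_z b F i rho) (sum_z b F i rho 0).
    by move=> i1; apply: ccvg_at_right; exact: sum_z_continuous.
  have := ccvgB (ccvgM (cy 0%N isT) (cz 1%N isT)) (ccvgM (cz 0%N isT) (cy 1%N isT)).
  by rewrite y0 z1 z0 y1; apply; exact: at_right_proper_filter.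
have x1 : 0 < x 1%N by rewrite -x0; exact: xlt.
apply: ccvg_unique (_ : ccvg 0^'+ (fun=> c) 1); first exact: ccvg_cst.
move: W; rewrite mulr1 mulr0 subr0; apply: ccvg_near; near=> s.
have s1 : s \in `]x 0%N, x 1%N[.
  rewrite x0 in_itv/=; apply/andP; split; near: s.
    exact: nbhs_right_gt.
  exact: nbhs_right_lt.
have sb := piece_sub x0 xb xlt (leq0n N) s1.
rewrite -(Hc 0%N s)// /wronskian !(@spps_cderive _ rho 0 s)//.
rewrite !(spps_sum_y b0 cF F0) ?(subset_itv_oo_cc sb)//.
have Fs := F0 s; rewrite -/F.
by field.
Unshelve. all: by end_near. Qed.

End spps.

Theorem theorem22 (R : realType) (b : R) (q : R -> R[i]) (N : nat)
    (x : nat -> R) (alpha : nat -> R[i]) (f : R -> R[i])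
    (hb : 0 < b) (hq : L2 `]0, b[ q) (hN : (0 < N)%N)
    (hx0 : x 0%N = 0) (hxb : x N.+1 = b)
    (hx : forall k, (k <= N)%N -> x k < x k.+1)
    (halpha : forall k, (1 <= k <= N)%N -> alpha k != 0)
    (hf : is_solution b q N x alpha 0 f)
    (hf0 : forall t, t \in `[0, b] -> f t != 0) :
  (forall rho : R[i],
    let u0 := spps f 0 rho in
    let u1 := spps f 1 rho in
    [/\ D2 b N x alpha u0 /\ D2 b N x alpha u1,
        fundamental_set b (is_solution b q N x alpha (rho ^+ 2)) u0 u1,
        [/\ u0 0 = f 0, is_rderive u0 0 (rderive f 0),
            u1 0 = 0 & is_rderive u1 0 (f 0)^-1] &
        forall i, (i <= 1)%N ->
          [/\ abs_unif_cvg `[0, b] (spps_term f i rho) (spps f i rho),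
              L2_cvg `]0, b[ (fun k => cderive (spps_term f i rho k))
                (cderive (spps f i rho)) &
              forall j, (j <= N)%N ->
                L2_cvg `]x j, x j.+1[
                  (fun k => cderive (cderive (spps_term f i rho k)))
                  (cderive (cderive (spps f i rho)))]]) /\
  (forall K : set R[i], compact (K : set R[i]^o) ->
    forall i, (i <= 1)%N ->
      [/\ abs_unif_cvg (K `*` `[0, b])
            (fun k y => spps_term f i y.1 k y.2) (fun y => spps f i y.1 y.2),
          L2_abs_unif_cvg K `]0, b[
            (fun rho k => cderive (spps_term f i rho k))
            (fun rho => cderive (spps f i rho)) &
          forall j, (j <= N)%N ->
            L2_abs_unif_cvg K `]x j, x j.+1[
              (fun rho k => cderive (cderive (spps_term f i rho k)))
              (fun rho => cderive (cderive (spps f i rho)))]).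
Proof.
split; last first.
  move=> K /compact_normc_bounded[P KP] i i1.
  split; first exact: (spps_abs_unif_cvg hb hf hf0 i1 KP).
    exact: (spps_cderive_unif_cvg hb hx0 hxb hx hf hf0 i1 KP).
  exact: (spps_cderive2_unif_cvg hb hq hx0 hxb hx hf hf0 i1 KP).
move=> rho u0 u1.
have S i : (i <= 1)%N -> is_solution b q N x alpha (rho ^+ 2) (spps f i rho).
  exact: (spps_solution hb hq hx0 hxb hx hf hf0).
have in0 : 0 \in `[0, b] by rewrite in_itv/= lexx ltW.
have cF := D2_ccontinuous hb hf.1.
have F0 t : (f \o clamp b) t != 0 by apply: hf0; exact: clamp_in.
have u0E : u0 0 = f 0.
  by rewrite /u0 (spps_sum_y hb cF F0)// (sum_y0 f hb)//= mulr1 clamp_id.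
have u1E : u1 0 = 0.
  by rewrite /u1 (spps_sum_y hb cF F0)// (sum_y0 f hb)//= mulr0.
have x1 : 0 < x 1%N by rewrite -hx0; exact: hx.
have [d fd] : exists d, ccvg 0^'+ (cderive f) d.
  have [[_ fH _] _] := hf; have [_ fac _ _] := fH 0%N (leq0n N).
  by apply: (abs_cont_cvg_right x1); rewrite -{1}hx0.
(* f = F y with y = 1 and z = 0. *)
have fr : is_rderive f 0 d.
  rewrite (_ : d = d * 1 + ((f \o clamp b) 0)^-1 * 0); last by rewrite mulr1 mulr0 addr0.
  apply: (factor_rderive hb hx0 hxb hx hf hf0 (y := fun=> 1) (z := fun=> 0)) => //.
  - by move=> t tb; rewrite mulr1 /= clamp_id.
  - exact: ccontinuous_cst.
  - exact: ccontinuous_cst.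
  - by move=> t _; rewrite mulr0; exact: is_cderive_cst.
have dE : rderive f 0 = d.
  by case: fr => fr fi; apply: complex_eq; exact: cvg_lim.
split.
- by split; [exact: (S 0%N isT).1|exact: (S 1%N isT).1].
- apply: (wronskian_fundamental hb hx0 hxb hx); [exact: S|exact: S| | |exact: u1E].
    by move=> t; exact: (spps_wronskian hb hq hx0 hxb hx hf hf0).
  by rewrite u0E; exact: hf0.
- split=> //.
    have := spps_rderive hb hx0 hxb hx hf hf0 rho (leqnSn 0) fd.
    by rewrite mulr1 mulr0 addr0 dE.
  have := spps_rderive hb hx0 hxb hx hf hf0 rho (leqnn 1) fd.
  by rewrite mulr0 add0r mulr1 /= clamp_id.
move=> i i1.
have KP r : [set rho] r -> normc r <= normc rho by move=> ->.
have [A1 A2] := spps_abs_unif_cvg hb hf hf0 i1 KP.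
have B := spps_cderive_unif_cvg hb hx0 hxb hx hf hf0 i1 KP.
split.
- split=> [t tb|e e0]; first exact: (A1 (rho, t)).
  by apply: filterS (A2 e e0) => n Hn t tb; exact: (Hn (rho, t)).
- apply: (L2_abs_unif_cvg_L2 _ _ B) => [k|].
    exact: (spps_term_L2 hb hx0 hxb hx hf hf0).
  exact: (spps_L2 hb hx0 hxb hx hf hf0).
move=> j jN; have C := spps_cderive2_unif_cvg hb hq hx0 hxb hx hf hf0 i1 KP jN.
apply: (L2_abs_unif_cvg_L2 _ _ C) => [k|].
  exact: (spps_term_L2_piece hb hq hx0 hxb hx hf hf0).
have [[_ uH _] _] := S i i1.
by have [] := uH j jN.
Qed.
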